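(* Let $n\ge 3$, $0<a<1$, and let $A=\{x\in\mathbb{R}^n:\ a<|x|<1\}$. Then for all $x,y\in A$ with $x\ne y$ the Green function of $-\Delta$ in $A$ with Dirichlet boundary conditions is given by $$G_A(x,y)=\frac{1}{(n-2)\omega_{n-1}|x-y|^{n-2}}-\frac{1}{\omega_{n-1}}\sum_{m=0}^{\infty}\frac{|x|^{2m+n-2}|y|^{2m+n-2}-a^{2m+n-2}\left(|x|^{2m+n-2}+|y|^{2m+n-2}\right)+a^{2m+n-2}}{(2m+n-2)(|x||y|)^{n+m-2}(1-a^{2m+n-2})}\,Z_m\!\left(\frac{x}{|x|},\frac{y}{|y|}\right).$$ Moreover, setting $d_0=1$ and $d_m=\binom{n+m-2}{n-2}+\binom{n+m-3}{n-2}$ for $m\ge 1$, the Robin function is given, for all $x\in A$, by $$R_A(x)=-\frac{1}{\omega_{n-1}}\sum_{m=0}^{\infty}d_m\,\frac{a^{2m+n-2}-2a^{2m+n-2}|x|^{2m+n-2}+|x|^{4m+2n-4}}{(2m+n-2)|x|^{2m+2n-4}(1-a^{2m+n-2})}.$$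
   Context: $\omega_{n-1}$ denotes the surface area of the unit sphere $S\subset\mathbb{R}^n$. The Green function $G_A$ is defined, for $y\in A$, by $-\Delta_x G_A(x,y)=\delta_y(x)$ in $A$ and $G_A(x,y)=0$ for $x\in\partial A$, where $\delta_y$ is the Dirac measure at $y$. It can be written as $G_A(x,y)=\frac{1}{(n-2)\omega_{n-1}|x-y|^{n-2}}+H(x,y)$, where $H$ is smooth on $A\times A$ and harmonic in each variable. The Robin function is $R_A(x)=H(x,x)$. The zonal harmonics $Z_m(x,\xi)$, for $x\in\mathbb{R}^n$ and $\xi\in S$, are defined by $Z_0(x,\xi)=1$ and, for $m\ge1$, $$Z_m(x,\xi)=(n+2m-2)\sum_{k=0}^{[m/2]}(-1)^k\frac{n(n+2)\cdots(n+2m-2k-4)}{2^k\,k!\,(m-2k)!}(x\cdot\xi)^{m-2k}|x|^{2k},$$ where $[m/2]$ is the integer part and the product $n(n+2)\cdots(n+2m-2k-4)$ is equal to $1$ when it is empty. *)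

(* Defs.v *)
From HB Require Import structures.
From mathcomp Require Import all_boot all_order all_algebra.
From mathcomp Require Import all_classical all_reals all_analysis.

Set Implicit Arguments.
Unset Strict Implicit.
Unset Printing Implicit Defensive.

Import Order.TTheory GRing.Theory Num.Theory.
Import numFieldNormedType.Exports.

Local Open Scope classical_set_scope.
Local Open Scope ring_scope.

(* The library norm on 'rV[R]_n is the sup norm; it is only used for the
   topology and for derivatives, where it is equivalent to enorm. *)
Definition dotp (R : realType) (n : nat) (x y : 'rV[R]_n) : R :=
  \sum_(i < n) x 0 i * y 0 i.

Definition enorm (R : realType) (n : nat) (x : 'rV[R]_n) : R :=
  Num.sqrt (dotp x x).

Definition annulus (R : realType) (n : nat) (a : R) : set 'rV[R]_n :=
  [set x | a < enorm x < 1].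
Arguments annulus {R} n a _.

Definition frontier (T : topologicalType) (A : set T) : set T :=
  closure A `\` interior A.

(* C^k on an open set U of a finite-dimensional space V: all iterated
   directional derivatives up to order k exist and are continuous on U. *)
Fixpoint Ck (R : realType) (V : normedModType R) (k : nat) (U : set V)
    (f : V -> R) : Prop :=
  (forall x, U x -> {for x, continuous f}) /\
  match k with
  | 0 => True
  | k'.+1 => forall v : V,
      (forall x, U x -> derivable f x v) /\ Ck k' U ('D_v f)
  end.

Definition smooth (R : realType) (V : normedModType R) (U : set V)
    (f : V -> R) : Prop :=
  forall k, Ck k U f.

Definition partial (R : realType) (n : nat) (i : 'I_n) (f : 'rV[R]_n -> R) :
    'rV[R]_n -> R :=
  'D_(delta_mx 0 i) f.

Definition laplacian (R : realType) (n : nat) (f : 'rV[R]_n -> R)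
    (x : 'rV[R]_n) : R :=
  \sum_(i < n) partial i (partial i f) x.

Definition harmonic_on (R : realType) (n : nat) (U : set 'rV[R]_n)
    (f : 'rV[R]_n -> R) : Prop :=
  Ck 2 U f /\ (forall x, U x -> laplacian f x = 0).

(* Lebesgue integral over R^n, as an iterated integral; by Tonelli and Fubini
   this is the integral against n-dimensional Lebesgue measure whenever f is
   Borel and either nonnegative or integrable. *)
Fixpoint integralRn (R : realType) (n : nat) :
    ('rV[R]_n -> \bar R) -> \bar R :=
  match n with
  | 0 => fun f => f 0
  | n'.+1 => fun f =>
      (\int[lebesgue_measure]_(t in [set: R])
         integralRn (fun v : 'rV[R]_n' =>
           f (row_mx (t%:M : 'rV[R]_1) v : 'rV[R]_(1 + n'))))%E
  end.

Definition graph_area (R : realType) (k : nat) (D : set 'rV[R]_k)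
    (g : 'rV[R]_k -> R) : R :=
  fine (integralRn (fun u =>
    (Num.sqrt (1 + \sum_(i < k) (partial i g u) ^+ 2) * \1_D u)%:E)).

(* Area of the unit sphere of dimension k, in R^(k+1): the two open
   hemispheres are the graphs of u |-> +/- sqrt (1 - |u|^2) over the unit ball
   of R^k, and the equator they omit has zero area. *)
Definition sphere_area (R : realType) (k : nat) : R :=
  2 * graph_area [set u : 'rV[R]_k | enorm u < 1]
                 (fun u => Num.sqrt (1 - enorm u ^+ 2)).

Definition test_function (R : realType) (n : nat) (A : set 'rV[R]_n)
    (phi : 'rV[R]_n -> R) : Prop :=
  smooth setT phi /\
  exists K : set 'rV[R]_n,
    [/\ compact K, K `<=` A & forall x, ~ K x -> phi x = 0].

(* - Delta f = delta_y in the sense of distributions on A. *)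
Definition neg_laplacian_dirac (R : realType) (n : nat) (A : set 'rV[R]_n)
    (f : 'rV[R]_n -> R) (y : 'rV[R]_n) : Prop :=
  (forall K : set 'rV[R]_n, compact K -> K `<=` A ->
     (integralRn (fun x => (`|f x| * \1_K x)%:E) < +oo)%E) /\
  (forall phi : 'rV[R]_n -> R, test_function A phi ->
     integralRn (fun x => (f x * - laplacian phi x)%:E) = (phi y)%:E).

(* The boundary condition is the classical one: G(., y) is continuous up to
   the boundary (away from the pole y) and vanishes there. *)
Definition green_function (R : realType) (n : nat) (A : set 'rV[R]_n)
    (G : 'rV[R]_n -> 'rV[R]_n -> R) : Prop :=
  forall y, A y ->
    [/\ neg_laplacian_dirac A (G^~ y) y,
        {within closure A `\ y, continuous (G^~ y)}
      & forall x, frontier A x -> G x y = 0].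

Definition fundamental_solution (R : realType) (n : nat) (x y : 'rV[R]_n) : R :=
  1 / ((n - 2)%:R * sphere_area R n.-1 * enorm (x - y) ^+ (n - 2)).

Definition regular_part (R : realType) (n : nat) (A : set 'rV[R]_n)
    (G H : 'rV[R]_n -> 'rV[R]_n -> R) : Prop :=
  [/\ smooth (A `*` A) (fun p : 'rV[R]_n * 'rV[R]_n => H p.1 p.2),
      forall y, A y -> harmonic_on A (H^~ y),
      forall x, A x -> harmonic_on A (H x)
    & forall x y, A x -> A y -> x != y ->
        G x y = fundamental_solution x y + H x y].

Definition robin_function (R : realType) (n : nat)
    (H : 'rV[R]_n -> 'rV[R]_n -> R) (x : 'rV[R]_n) : R := H x x.

Definition zonal (R : realType) (n m : nat) (x xi : 'rV[R]_n) : R :=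
  if m == 0%N then 1
  else (n + 2 * m - 2)%:R *
    \sum_(0 <= k < (m./2).+1)
      (-1) ^+ k *
      ((\prod_(0 <= j < m - k - 1) (n + 2 * j))%N%:R /
       (2 ^ k * k`! * (m - 2 * k)`!)%N%:R) *
      dotp x xi ^+ (m - 2 * k) * enorm x ^+ (2 * k).

Definition harmonic_dim (n m : nat) : nat :=
  if m == 0%N then 1%N else ('C(n + m - 2, n - 2) + 'C(n + m - 3, n - 2))%N.

(* Main.v *)
(** The regular part H(., y) is harmonic in the annulus with boundary values
    minus the fundamental solution, so the distributional equation is not
    needed: the maximum principle determines H.  The m-th term of the series is
    C_m(T) (alpha |x|^m + beta |x|^(-(m+n-2))), with C_m the Gegenbauer polynomial
    of index (n-2)/2 and T the cosine of the angle between x and y; it is harmonic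
    off the origin by the Gegenbauer equation.  On |x| = 1 and on |x| = a the
    series reduces to the generating function of the C_m at |y| and at a/|y|, i.e.
    to a multiple of |x-y|^(2-n), with an error for the partial sums that is
    uniform in x.  The maximum principle applied to H plus a multiple of a partial
    sum, a finite sum which can be differentiated term by term, gives the formula
    for H, and x = y gives the Robin function since Z_m(xi, xi) = d_m. *)
Require Import Defs.
From HB Require Import structures.
From mathcomp Require Import all_boot all_order all_algebra.
From mathcomp Require Import all_classical all_reals all_analysis.
From mathcomp Require Import zify ring lra.

Set Implicit Arguments.
Unset Strict Implicit.
Unset Printing Implicit Defensive.

Import Order.TTheory GRing.Theory Num.Theory.
Import numFieldNormedType.Exports.

Local Open Scope classical_set_scope.
Local Open Scope ring_scope.

(** * Gegenbauer polynomials *)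

Section Gegenbauer.
Context {R : realType}.
Implicit Types (v m k l i : nat) (t r : R).

(** With [v = 2 lambda], the factor [(lambda)_(k+l) 2^l] of the classical coefficient equals this
    product over [2^k], so a half-integer index only involves natural numbers. The pair [(k, l)]
    stands for degree [l] in the polynomial of index [k.*2 + l], which avoids a truncated
    subtraction. *)
Definition gegen_coef v k l : R :=
  (-1) ^+ k * (\prod_(0 <= j < k + l) (v + 2 * j))%N%:R
  / (2 ^ k * k`! * l`!)%N%:R.

(* The Gegenbauer polynomial C_m^(v/2); its coefficient of degree
   l = m - 2k is gegen_coef v k l. *)
Definition gegen v m : {poly R} :=
  \poly_(i < m.+1) if odd (m - i) then 0 else gegen_coef v (m - i)./2 i.

Lemma coef_gegen_even v k l : (gegen v (k.*2 + l))`_l = gegen_coef v k l.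
Proof.
by rewrite coef_poly ltnS leq_addl addnK odd_double doubleK.
Qed.

Lemma coef_gegen_small v m i : (m < i)%N -> (gegen v m)`_i = 0.
Proof. by move=> mi; rewrite coef_poly ltnS leqNgt mi. Qed.

Lemma coef_gegen_odd v m i : odd (m - i) -> (gegen v m)`_i = 0.
Proof. by move=> o; rewrite coef_poly o if_same. Qed.

Lemma pow2_fact_neq0 k l : (2 ^ k * k`! * l`!)%N%:R != 0 :> R.
Proof. by rewrite pnatr_eq0 -lt0n !muln_gt0 expn_gt0 !fact_gt0. Qed.

(** The pairs [(k, l.+2)] and [(k.+1, l)] belong to the same polynomial, of index [k.*2 + l.+2];
    this relation between neighbouring coefficients is the Gegenbauer equation. *)
Lemma gegen_coef_ode v k l :
  gegen_coef v k l.+2 * l.+2%:R * l.+1%:R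
  = - (gegen_coef v k.+1 l * k.+1.*2%:R * (v + 2 * (k + l).+1)%:R).
Proof.
rewrite /gegen_coef.
have -> : (k + l.+2 = (k + l).+2)%N by lia.
have -> : (k.+1 + l = (k + l).+1)%N by lia.
rewrite big_nat_recr //= exprS natrM.
have := pow2_fact_neq0 k l.
have -> : (v + 2 * (k + l).+1 = v + 2 * k + 2 * l + 2)%N by lia.
rewrite !factS expnS -!muln2 !natrM !natrD ?natrM.
rewrite -[k.+1%:R]natr1 -[l.+2%:R]natr1 -[l.+1%:R]natr1.
move=> h0.
have hk : k%:R + 1 != 0 :> R by rewrite natr1 pnatr_eq0.
have hl : l%:R + 1 != 0 :> R by rewrite natr1 pnatr_eq0.
have hl2 : l%:R + 1 + 1 != 0 :> R by rewrite !natr1 pnatr_eq0.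
move: h0; rewrite !mulf_eq0 !negb_or => /andP[/andP[h1 h2] h3].
by field; rewrite hk hl hl2 h1 h2 h3 ?pnatr_eq0.
Qed.

(** The three-term recurrence in coefficients, for index [m = l + k.*2]: the term with [X] lowers
    [l], the term of index [m - 2] lowers [k]. An absent neighbour counts as 0, so [m - 2] is
    multiplied by 0 when it is truncated. *)
Lemma gegen_coef_rec v k l : (0 < k + l)%N ->
  (l + k.*2)%:R * gegen_coef v k l =
  (2 * (l + k.*2) - 2 + v)%:R * (if l is l'.+1 then gegen_coef v k l' else 0)
  - ((l + k.*2 - 2) + v)%:R * (if k is k'.+1 then gegen_coef v k' l else 0).
Proof.
case: k l => [|k] [|l] //= _.
- rewrite /gegen_coef !add0n !mulr0 subr0.
  rewrite big_nat_recr //= factS fact0 expr0 expn0.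
  have -> : (2 * (l.+1 + 0.*2) - 2 + v = v + 2 * l)%N by rewrite double0; lia.
  have -> : (l.+1 + 0.*2 = l.+1)%N by rewrite double0; lia.
  rewrite !natrM !natrD -[l.+1%:R]natr1.
  have hl : l%:R + 1 != 0 :> R by rewrite natr1 pnatr_eq0.
  have h3 : l`!%:R != 0 :> R by rewrite pnatr_eq0 -lt0n fact_gt0.
  by field; rewrite hl h3.
- rewrite /gegen_coef !addn0 mulr0 sub0r.
  rewrite big_nat_recr //= !factS expnS exprS.
  have -> : (0 + k.+1.*2 - 2 + v = v + 2 * k)%N by lia.
  have -> : (0 + k.+1.*2 = 2 * k.+1)%N by lia.
  have := pow2_fact_neq0 k 0.
  rewrite !natrM !natrD -[k.+1%:R]natr1.
  rewrite !mulf_eq0 !negb_or => /andP[/andP[h1 h2] h3].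
  have hk : k%:R + 1 != 0 :> R by rewrite natr1 pnatr_eq0.
  by field; rewrite hk h1 h2 h3 ?pnatr_eq0.
- rewrite /gegen_coef.
  have -> : (k.+1 + l.+1 = (k + l).+2)%N by lia.
  have -> : (k.+1 + l = (k + l).+1)%N by lia.
  have -> : (k + l.+1 = (k + l).+1)%N by lia.
  rewrite big_nat_recr //= !factS expnS exprS.
  have -> : (2 * (l.+1 + k.+1.*2) - 2 + v = 2 * l + 4 * k + 4 + v)%N by lia.
  have -> : (l.+1 + k.+1.*2 - 2 + v = l + 2 * k + 1 + v)%N by lia.
  have -> : (l.+1 + k.+1.*2 = l + 2 * k + 3)%N by lia.
  have := pow2_fact_neq0 k l.
  have -> : (v + 2 * (k + l).+1 = v + 2 * k + 2 * l + 2)%N by lia.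
  rewrite !natrM !natrD ?natrM -[k.+1%:R]natr1 -[l.+1%:R]natr1.
  rewrite !mulf_eq0 !negb_or => /andP[/andP[h1 h2] h3].
  have hk : k%:R + 1 != 0 :> R by rewrite natr1 pnatr_eq0.
  have hl : l%:R + 1 != 0 :> R by rewrite natr1 pnatr_eq0.
  by field; rewrite hk hl h1 h2 h3 ?pnatr_eq0.
Qed.

Lemma coef_gegen_ode v m i :
  (gegen v m)`_i.+2 * i.+2%:R * i.+1%:R
  = - ((m%:R - i%:R) * (m + i + v)%:R * (gegen v m)`_i).
Proof.
have [mi|im] := ltnP m i.
  by rewrite !coef_gegen_small ?mul0r ?mulr0 ?oppr0 //; lia.
have [h1|ev] := boolP (odd (m - i)).
  case: (boolP (odd (m - i.+2))) => [h2|].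
    by rewrite !coef_gegen_odd ?mul0r ?mulr0 ?oppr0.
  move=> ?; rewrite (coef_gegen_odd _ h1) coef_gegen_small ?mul0r ?mulr0 ?oppr0 //.
  by lia.
have -> : m = ((m - i)./2.*2 + i)%N by lia.
case: (m - i)./2 => [|k].
  by rewrite coef_gegen_small ?double0 ?subrr ?mul0r ?oppr0 //; lia.
rewrite coef_gegen_even.
have -> : (k.+1.*2 + i = k.*2 + i.+2)%N by lia.
rewrite coef_gegen_even gegen_coef_ode; congr (- _).
rewrite -natrB; last by lia.
have -> : (k.*2 + i.+2 - i = k.+1.*2)%N by lia.
have -> : (k.*2 + i.+2 + i + v = v + 2 * (k + i).+1)%N by lia.
by rewrite [RHS]mulrC mulrA.
Qed.

(** [X p'] and [X^2 p''] multiply the coefficient of degree [i] by [i] and [i (i - 1)], so the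
    equation can be checked degree by degree, from [(m - i) (m + i + v) = m (m + v) - i (i + v)]. *)
Lemma gegen_ode v m t :
  (1 - t ^+ 2) * (gegen v m)^`()^`().[t] - v.+1%:R * t * (gegen v m)^`().[t]
  + m%:R * (m + v)%:R * (gegen v m).[t] = 0.
Proof.
set p := gegen v m.
have : p^`()^`() - 'X^2 * p^`()^`() - v.+1%:R *: ('X * p^`())
       + (m%:R * (m + v)%:R) *: p = 0.
  apply/polyP => i.
  have e1 : ('X * p^`())`_i = p`_i * i%:R.
    by case: i => [|i]; rewrite coefXM ?mulr0 //= coef_deriv mulr_natr.
  have e2 : ('X^2 * p^`()^`())`_i = p`_i * i%:R * (i%:R - 1).
    case: i {e1} => [|[|i]]; rewrite coefXnM ?mulr0 ?mul0r ?subrr ?mulr0 //=.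
    by rewrite subn2 /= !coef_deriv -[i.+2%:R]natr1 addrK natr1 !mulr_natr.
  have e3 : p^`()^`()`_i = - ((m%:R - i%:R) * (m + i + v)%:R * p`_i).
    by rewrite !coef_deriv -coef_gegen_ode !mulr_natr.
  rewrite !(coefD, coefN, coefZ) e1 e2 e3 coef0 !natrD -[v.+1%:R]natr1.
  by ring.
move/(congr1 (horner^~ t)); rewrite horner0 => <-.
by rewrite !(hornerD, hornerN, hornerZ, hornerM, hornerX, hornerXn); ring.
Qed.

Lemma coef_gegen_rec v m i :
  m.+2%:R * (gegen v m.+2)`_i =
  (2 * m.+1 + v)%:R * ('X * gegen v m.+1)`_i - (m + v)%:R * (gegen v m)`_i.
Proof.
rewrite coefXM.
have [mi|im] := ltnP m.+2 i.
  case: i mi => [|i] //= mi.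
  by rewrite !coef_gegen_small ?mulr0 ?subr0 //; lia.
have [h1|ev] := boolP (odd (m.+2 - i)).
  rewrite (coef_gegen_odd _ h1) mulr0.
  have -> : (gegen v m)`_i = 0.
    case: (ltnP m i) => [|im']; first exact: coef_gegen_small.
    by apply: coef_gegen_odd; lia.
  rewrite mulr0 subr0; case: i h1 {im} => [|i] h1 /=; rewrite ?mulr0 //.
  by rewrite coef_gegen_odd ?mulr0 //; lia.
have [k mE] : exists k, m.+2 = (k.*2 + i)%N.
  by exists (m.+2 - i)./2; lia.
rewrite mE coef_gegen_even [(k.*2 + i)%N]addnC gegen_coef_rec; last by lia.
have -> : (2 * (i + k.*2) - 2 + v = 2 * m.+1 + v)%N by lia.
have -> : (i + k.*2 - 2 + v = m + v)%N by lia.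
congr (_ * _ - _ * _).
- case: i mE {im ev} => [|i] //= mE.
  have -> : m.+1 = (k.*2 + i)%N by lia.
  by rewrite coef_gegen_even.
- case: k mE {im ev} => [|k'] mE.
    by rewrite coef_gegen_small //; lia.
  have -> : m = (k'.*2 + i)%N by lia.
  by rewrite coef_gegen_even.
Qed.

Lemma gegen_rec v m t :
  m.+2%:R * (gegen v m.+2).[t] =
  (2 * m.+1 + v)%:R * t * (gegen v m.+1).[t] - (m + v)%:R * (gegen v m).[t].
Proof.
have : m.+2%:R *: gegen v m.+2 =
    (2 * m.+1 + v)%:R *: ('X * gegen v m.+1) - (m + v)%:R *: gegen v m.
  by apply/polyP => i; rewrite coefZ coefB !coefZ coef_gegen_rec.
by move/(congr1 (horner^~ t));
  rewrite !(hornerD, hornerN, hornerZ, hornerM, hornerX) mulrA.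
Qed.

Lemma gegen0 v : gegen v 0 = 1.
Proof.
apply/polyP => -[|i]; rewrite coef_poly coef1 //=.
by rewrite /gegen_coef big_geq //= mul1r divr1.
Qed.

Lemma gegen1 v : gegen v 1 = v%:R *: 'X.
Proof.
apply/polyP => i; rewrite coef_poly coefZ coefX.
case: i => [|[|i]] //=; rewrite ?mulr0 ?mulr1 //.
by rewrite /gegen_coef big_nat_recr //= big_geq //= mul1r mul1n divr1 muln0 addn0.
Qed.

Lemma gegenN v m t : (gegen v m).[- t] = (-1) ^+ m * (gegen v m).[t].
Proof.
rewrite !horner_poly mulr_sumr; apply: eq_bigr => i _.
case: ifPn => [_|e]; first by rewrite !mul0r mulr0.
have -> : (-1) ^+ m = (-1) ^+ i :> R.
  by rewrite -signr_odd -[RHS]signr_odd; congr (_ ^+ nat_of_bool _); have := ltn_ord i; lia.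
by rewrite [(- t) ^+ _]exprNn mulrCA.
Qed.

(** At [t = 1] the recurrence becomes a relation between binomials, which follows from the
    absorption identity [down]. *)
Lemma gegen_at1 v m : (gegen v.+1 m).[1] = 'C(m + v, v)%:R.
Proof.
elim/ltn_ind: m => -[|[|m]] IH.
- by rewrite gegen0 hornerE add0n binn.
- by rewrite gegen1 !hornerE add1n binSn.
have h : m.+2%:R != 0 :> R by rewrite pnatr_eq0.
apply: (mulfI h); rewrite gegen_rec mulr1 !IH //.
apply/eqP; rewrite subr_eq -!natrM -natrD eqr_nat; apply/eqP.
have down k : (k.+1 * 'C(k.+1 + v, v) = (k + v.+1) * 'C(k + v, v))%N.
  have := mul_bin_down (k.+1 + v) v; rewrite addnK addSn /= => <-.
  by rewrite addnS.
rewrite (down m.+1) -(down m) -mulnDl.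
by congr (_ * _)%N; lia.
Qed.

(* The polynomial K C^2 + (1 - X^2) C'^2 with K = m (m + v) has derivative
   2 v X C'^2 by the Gegenbauer equation, hence increases on [0, 1]. *)
Lemma gegen_bound v m t : `|t| <= 1 ->
  `|(gegen v m).[t]| <= `|(gegen v m).[1]|.
Proof.
wlog t0 : t / 0 <= t.
  move=> W; have [/W//|/ltW tle0 tle1] := leP 0 t.
  have := W (- t); rewrite oppr_ge0 normrN gegenN normrM normrX normrN1 expr1n.
  by rewrite mul1r; exact.
rewrite (ger0_norm t0) => t1.
case: m => [|m]; first by rewrite gegen0 !hornerE.
set p := gegen v m.+1.
pose K : R := m.+1%:R * (m.+1 + v)%:R.
have K0 : 0 < K by rewrite mulr_gt0 // ltr0n.
pose E : {poly R} := K *: p ^+ 2 + (1 - 'X^2) * p^`() ^+ 2.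
have dE s : E^`().[s] = 2 * v%:R * s * p^`().[s] ^+ 2.
  have := gegen_ode v m.+1 s; rewrite -/p -/K => ode.
  rewrite /E !expr2 !(derivD, derivZ, derivM, derivN, derivC, derivX).
  rewrite !(hornerD, hornerN, hornerZ, hornerM, hornerX, hornerC).
  move: ode; rewrite -[v.+1%:R]natr1 => ode.
  transitivity (2 * p^`().[s] * ((1 - s ^+ 2) * (p^`())^`().[s]
      - (v%:R + 1) * s * p^`().[s] + K * p.[s])
      + 2 * v%:R * s * p^`().[s] ^+ 2); last by rewrite ode mulr0 add0r expr2.
  by ring.
have EE s : E.[s] = K * p.[s] ^+ 2 + (1 - s ^+ 2) * p^`().[s] ^+ 2.
  by rewrite /E !(hornerD, hornerN, hornerZ, hornerM, hornerC, horner_exp, hornerX) -!expr2.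
have Ele : E.[t] <= E.[1].
  have [->//|tn1] := eqVneq t 1.
  have tlt1 : t < 1 by rewrite lt_neqAle tn1.
  have cE : {within `[t, 1], continuous (horner E)}.
    by apply: continuous_subspaceT; exact: continuous_horner.
  have [c] := MVT tlt1 (fun s _ => is_derive_poly E s) cE.
  rewrite in_itv /= => /andP[tc c1].
  rewrite dE => /eqP; rewrite subr_eq => /eqP ->.
  rewrite lerDr; apply: mulr_ge0; last by rewrite subr_ge0.
  apply: mulr_ge0; last exact: sqr_ge0.
  by rewrite !mulr_ge0 //; exact: le_trans t0 (ltW tc).
rewrite -ler_sqr ?nnegrE // !real_normK ?num_real // -(ler_pM2l K0).
move: Ele; rewrite !EE expr1n subrr mul0r addr0; apply: le_trans.
by rewrite lerDl mulr_ge0 ?sqr_ge0 // subr_ge0 expr_le1.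
Qed.

End Gegenbauer.

(** * Generating function of the Gegenbauer polynomials, with an explicit error for partial sums *)

Section GegenbauerGeneratingFunction.
Context {R : realType}.
Implicit Types (p m k M : nat) (t r : R).

(** With [s] the midpoint of [r] and 1, ['C(m + p, p) s^m (1 - s)^p] is one term of the expansion of
    [(s + (1 - s))^(m + p) = 1], hence at most 1. This gives [K = (1 - s)^(-p)] and [q = r / s]. *)
Lemma bin_geometric p r : 0 <= r < 1 ->
  exists K q : R, [/\ 0 <= K, 0 <= q < 1 &
    forall m, 'C(m + p, p)%:R * r ^+ m <= K * q ^+ m].
Proof.
move=> /andP[r0 r1]; pose s := (1 + r) / 2.
have s0 : 0 < s by rewrite /s; lra.
have s1 : 0 < 1 - s by rewrite /s; lra.
have sp : 0 < (1 - s) ^+ p by rewrite exprn_gt0.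
exists ((1 - s) ^+ p)^-1, (r / s); split.
- by rewrite invr_ge0 ltW.
- by rewrite divr_ge0 ?(ltW s0) //= ltr_pdivrMr // mul1r /s; lra.
move=> m; rewrite expr_div_n mulrA ler_pdivlMr ?exprn_gt0 // mulrAC.
rewrite ler_wpM2r ?exprn_ge0 // -[leRHS]mul1r ler_pdivlMr //.
rewrite [leRHS](_ : 1 = (s + (1 - s)) ^+ (m + p)); last by rewrite addrC subrK expr1n.
rewrite [leRHS]exprDn.
have hp : (p < (m + p).+1)%N by lia.
rewrite (bigD1 (Ordinal hp)) //= addnK -[X in _ <= X + _]mulr_natl mulrA lerDl.
by apply: sumr_ge0 => i _; rewrite mulrn_wge0 // mulr_ge0 ?exprn_ge0 // ltW.
Qed.

(** The bound produced by the mean value argument of [gegen_gen]; it does not depend on the cosine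
    [t]. *)
Definition gegen_gen_error p r M : R :=
  2 ^+ p.+1 * p.+1%:R / (1 - r) ^+ p.+2 * ('C(M + p.+1, p.+1)%:R * r ^+ M).

Lemma gegen_gen_error_ge0 p r M : 0 <= r < 1 -> 0 <= gegen_gen_error p r M.
Proof.
by move=> /andP[r0 r1]; rewrite !mulr_ge0 ?invr_ge0 ?exprn_ge0 // subr_ge0 ltW.
Qed.

Lemma cvg_gegen_gen_error p r : 0 <= r < 1 ->
  gegen_gen_error p r @ \oo --> (0 : R).
Proof.
move=> r01; have [K [q [K0 /andP[q0 q1] Kq]]] := bin_geometric p.+1 r01.
pose c := 2 ^+ p.+1 * p.+1%:R / (1 - r) ^+ p.+2.
have c0 : 0 <= c.
  by case/andP: r01 => ? ?; rewrite !mulr_ge0 ?invr_ge0 ?exprn_ge0 // subr_ge0 ltW.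
have h0 : (fun=> 0 : R) @ \oo --> (0 : R) by exact: cvg_cst.
have h1 : (fun M => c * (K * q ^+ M)) @ \oo --> (0 : R).
  rewrite -[X in _ --> X](mulr0 c) -[X in _ * X](mulr0 K).
  apply: cvgMr; apply: cvgMr; apply: cvg_expr.
  by rewrite ger0_norm.
apply: (squeeze_cvgr _ h0 h1); apply: nearW => M.
by rewrite gegen_gen_error_ge0 //= ler_wpM2l.
Qed.

Lemma gegen_le_bin p m t : `|t| <= 1 -> `|(gegen p.+1 m).[t]| <= 'C(m + p, p)%:R.
Proof.
by move=> t1; apply: le_trans (gegen_bound _ _ t1) _; rewrite gegen_at1 ger0_norm.
Qed.

Definition gegen_sum v M t r : R := \sum_(m < M) (gegen v m).[t] * r ^+ m.

(* (1 - 2 t r + r^2) S' - v (t - r) S, where S is the partial sum: the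
   generating function annihilates this operator, by the recurrence only the two top
   terms survive in a partial sum. *)
Lemma gegen_sum_ode v M t r :
  (1 - 2 * t * r + r ^+ 2)
    * (\sum_(m < M.+1) (gegen v m).[t] * (r ^+ m.-1 *+ m))
  - v%:R * (t - r) * gegen_sum v M.+1 t r
  = (M + v)%:R * (gegen v M).[t] * r ^+ M.+1
    - M.+1%:R * (gegen v M.+1).[t] * r ^+ M.
Proof.
rewrite /gegen_sum; elim: M => [|M IH].
  rewrite !big_ord1 gegen0 gegen1 !hornerZ hornerC hornerX !expr0 !expr1.
  by rewrite mulr0n; ring.
rewrite big_ord_recr [in X in _ - X]big_ord_recr /=; move: IH.
move: (\sum_(m < M.+1) _) (\sum_(m < M.+1) _) => A B IH.
transitivity ((1 - 2 * t * r + r ^+ 2) * B - v%:R * (t - r) * A +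
   ((1 - 2 * t * r + r ^+ 2) * ((gegen v M.+1).[t] * (r ^+ M *+ M.+1))
   - v%:R * (t - r) * ((gegen v M.+1).[t] * r ^+ M.+1))); first by ring.
rewrite IH gegen_rec -mulr_natr !natrD natrM -natr1 !exprS.
by ring.
Qed.

(** The squared distance between two points at distances 1 and [r] from the origin, [t] being the
    cosine of the angle between them. *)
Definition gegen_quad t r : R := 1 - 2 * t * r + r ^+ 2.

Lemma gegen_quad_ge t r : `|t| <= 1 -> 0 <= r -> (1 - r) ^+ 2 <= gegen_quad t r.
Proof.
rewrite ler_norml => /andP[_ t1] r0; rewrite -subr_ge0.
have -> : gegen_quad t r - (1 - r) ^+ 2 = 2 * (r * (1 - t)).
  by rewrite /gegen_quad; ring.
by rewrite !mulr_ge0 // subr_ge0.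
Qed.

Lemma gegen_quad_le4 t r : `|t| <= 1 -> 0 <= r <= 1 -> gegen_quad t r <= 2 ^+ 2.
Proof.
rewrite ler_norml => /andP[t1 _] /andP[r0 r1]; rewrite /gegen_quad !expr2.
have h1 : 0 <= (t + 1) * r by rewrite mulr_ge0 //; lra.
have h2 : 0 <= r * (1 - r) by rewrite mulr_ge0 //; lra.
nra.
Qed.

Lemma sqrt_gegen_quad_ge t r : `|t| <= 1 -> 0 <= r <= 1 ->
  1 - r <= Num.sqrt (gegen_quad t r).
Proof.
move=> t1 /andP[r0 r1].
rewrite -(ger0_norm (_ : 0 <= 1 - r)) ?subr_ge0 // -sqrtr_sqr.
by rewrite ler_wsqrtr // gegen_quad_ge.
Qed.

Lemma is_derive_gegen_sum v M t r :
  is_derive r 1 (gegen_sum v M t)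
    (\sum_(m < M) (gegen v m).[t] * (r ^+ m.-1 *+ m)).
Proof.
have -> : gegen_sum v M t = \sum_(m < M) (fun s => (gegen v m).[t] * s ^+ m).
  by apply/funext => s; rewrite fct_sumE.
apply: is_derive_sum => m.
apply: is_deriveZ; have := is_deriveX m (is_derive_id r 1).
rewrite exprfctE => d; apply: is_derive_eq d _.
by rewrite [_ *: _]mulr1 mulr_natl.
Qed.

(** With [Q] the quadratic, [S] the partial sum and [v = p.+1], the derivative of [Q^(v/2) S] is
    [Q^(v/2 - 1) (Q S' - v (t - r) S)], and [gegen_sum_ode] evaluates the bracket. The power
    [v/2 - 1] is written as a quotient of powers of the square root, so that [p = 0] is covered. *)
Lemma gegen_gen_derive p M t r : `|t| <= 1 -> 0 <= r < 1 ->
  is_derive r 1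
    (fun s => Num.sqrt (gegen_quad t s) ^+ p.+1 * gegen_sum p.+1 M.+1 t s)
    (Num.sqrt (gegen_quad t r) ^+ p / Num.sqrt (gegen_quad t r) *
     ((M + p.+1)%:R * (gegen p.+1 M).[t] * r ^+ M.+1
      - M.+1%:R * (gegen p.+1 M.+1).[t] * r ^+ M)).
Proof.
move=> t1 /andP[r0 r1].
have Q0 : 0 < Num.sqrt (gegen_quad t r).
  by rewrite (lt_le_trans _ (sqrt_gegen_quad_ge _ _)) ?subr_gt0 // r0 ltW.
have dQ : is_derive r 1 (gegen_quad t) (2 * (r - t)).
  have -> : gegen_quad t = horner (1 - (2 * t) *: 'X + 'X^2).
    by apply/funext => s; rewrite /gegen_quad !(hornerD, hornerN, hornerZ, hornerX, hornerXn, hornerC).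
  apply: is_derive_eq.
  rewrite !(derivD, derivN, derivZ, derivX, derivXn, derivC) /= expr1 mulr2n.
  by rewrite !(hornerD, hornerN, hornerZ, hornerX, hornerC); ring.
have dS : is_derive r 1 (fun s => Num.sqrt (gegen_quad t s))
    ((r - t) / Num.sqrt (gegen_quad t r)).
  have := is_derive1_comp (is_derive1_sqrt _) dQ.
  rewrite -sqrtr_gt0 => /(_ Q0) d; apply: is_derive_eq d _.
  by field; rewrite gt_eqF.
have := is_deriveM (is_deriveX p.+1 dS) (is_derive_gegen_sum p.+1 M.+1 t r).
rewrite exprfctE => d; apply: is_derive_eq d _.
rewrite -gegen_sum_ode -/(gegen_quad t r) -[X in X * \sum_(m < _) _]sqr_sqrtr; last first.
  by rewrite ltW // -sqrtr_gt0.
move: (gegen_sum _ _ _ _) (\sum_(m < _) _) => A B.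
rewrite /GRing.scale /= exprS -mulr_natr.
by field; rewrite gt_eqF.
Qed.

(** The product [f] of the partial sum with the inverse of its expected limit is 1 at 0 and has a
    small derivative. The mean value theorem bounds [f r - 1], and dividing by [S r ^+ p.+1], which
    is at least [(1 - r)^(p+1)], gives the claim. *)
Lemma gegen_gen p M t r : `|t| <= 1 -> 0 <= r < 1 ->
  `|gegen_sum p.+1 M.+1 t r - (Num.sqrt (gegen_quad t r) ^+ p.+1)^-1|
  <= gegen_gen_error p r M.
Proof.
move=> t1 /andP[r0 r1].
pose S (s : R) : R := Num.sqrt (gegen_quad t s).
have Sge (s : R) : 0 <= s < 1 -> 1 - s <= S s.
  by move=> /andP[? ?]; apply: sqrt_gegen_quad_ge => //; apply/andP; split=> //; exact: ltW.
have Sgt (s : R) : 0 <= s < 1 -> 0 < S s.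
  by move=> s01; rewrite (lt_le_trans _ (Sge _ s01)) // subr_gt0; case/andP: s01.
pose f (s : R) : R := S s ^+ p.+1 * gegen_sum p.+1 M.+1 t s.
have f0 : f 0 = 1.
  rewrite /f /S /gegen_quad /gegen_sum big_ord_recl gegen0 hornerC.
  rewrite big1 => [|i _]; last by rewrite exprS mul0r mulr0.
  by rewrite mulr0 subr0 expr0n /= !addr0 sqrtr1 expr1n expr0 !mulr1.
suff H : `|f r - 1| <=
    2 ^+ p.+1 * p.+1%:R / (1 - r) * ('C(M + p.+1, p.+1)%:R * r ^+ M).
  have -> : gegen_sum p.+1 M.+1 t r - (S r ^+ p.+1)^-1 = (f r - 1) / S r ^+ p.+1.
    have Sr : S r ^+ p.+1 != 0 by rewrite gt_eqF // exprn_gt0 // Sgt // r0.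
    by rewrite /f mulrBl mul1r mulrAC divff // mul1r.
  rewrite normrM normfV (ger0_norm (exprn_ge0 _ (sqrtr_ge0 _))).
  have -> : gegen_gen_error p r M =
      2 ^+ p.+1 * p.+1%:R / (1 - r) * ('C(M + p.+1, p.+1)%:R * r ^+ M)
      / (1 - r) ^+ p.+1.
    rewrite /gegen_gen_error [(1 - r) ^+ p.+2]exprS.
    have r1' : 1 - r != 0 by rewrite gt_eqF // subr_gt0.
    by field; rewrite expf_neq0.
  rewrite ler_pM ?invr_ge0 ?exprn_ge0 ?sqrtr_ge0 //.
  rewrite lef_pV2 ?posrE ?exprn_gt0 ?subr_gt0 ?Sgt ?r0 //.
  by rewrite ler_pXn2r ?nnegrE ?subr_ge0 ?(ltW r1) ?sqrtr_ge0 // Sge // r0.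
have [->|rn0] := eqVneq r 0.
  by rewrite f0 subrr normr0 subr0 divr1 !mulr_ge0 ?exprn_ge0.
have rgt0 : 0 < r by rewrite lt_neqAle eq_sym rn0.
have df s : s \in `]0, r[ -> is_derive s 1 f
    (S s ^+ p / S s *
     ((M + p.+1)%:R * (gegen p.+1 M).[t] * s ^+ M.+1
      - M.+1%:R * (gegen p.+1 M.+1).[t] * s ^+ M)).
  rewrite in_itv /= => /andP[s0 sr]; apply: gegen_gen_derive => //.
  by rewrite (ltW s0) (lt_trans sr).
have cf : {within `[0, r], continuous f}.
  apply: derivable_within_continuous => s.
  rewrite in_itv /= => /andP[s0 sr].
  have s01 : 0 <= s < 1 by rewrite s0 (le_lt_trans sr).
  exact: (@ex_derive _ _ _ _ _ _ _ (gegen_gen_derive p M t1 s01)).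
have [c] := MVT rgt0 df cf.
rewrite in_itv /= f0 subr0 => /andP[c0 cr] ->.
have c01 : 0 <= c < 1 by rewrite (ltW c0) (lt_trans cr).
(* Both surviving terms of the derivative lead to the same number [p.+1 * 'C(M + p.+1, p.+1)] once
   the Gegenbauer values are bounded by binomials. *)
have Wn : (M.+1 * 'C(M.+1 + p, p) = p.+1 * 'C(M + p.+1, p.+1))%N.
  have := mul_bin_down (M.+1 + p) p; rewrite addnK addSn /= => <-.
  by rewrite mul_bin_diag addnS.
have Wn' : ((M + p.+1) * 'C(M + p, p) = p.+1 * 'C(M + p.+1, p.+1))%N.
  by rewrite addnS -mul_bin_diag.
pose W : R := 'C(M + p.+1, p.+1)%:R.
have hb : `|(M + p.+1)%:R * (gegen p.+1 M).[t] * c ^+ M.+1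
      - M.+1%:R * (gegen p.+1 M.+1).[t] * c ^+ M| <= 2 * (p.+1%:R * W * r ^+ M).
  apply: le_trans (ler_normB _ _) _.
  rewrite [leRHS]mulr_natl mulr2n; apply: lerD.
  - rewrite !normrM (ger0_norm (exprn_ge0 _ (ltW c0))) ger0_norm //.
    rewrite /W -natrM -Wn' natrM.
    apply: ler_pM => //; [by rewrite exprn_ge0 // ltW | |].
      by rewrite ler_wpM2l // gegen_le_bin.
    rewrite exprS -[leRHS]mul1r.
    apply: ler_pM; rewrite ?exprn_ge0 // ?(ltW c0) //; first by case/andP: c01 => _ /ltW.
    by rewrite lerXn2r ?nnegrE ?(ltW c0) // ltW.
  - rewrite !normrM (ger0_norm (exprn_ge0 _ (ltW c0))) ger0_norm //.
    rewrite /W -natrM -Wn natrM.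
    apply: ler_pM => //; [by rewrite exprn_ge0 // ltW | |].
      by rewrite ler_wpM2l // gegen_le_bin.
    by rewrite lerXn2r ?nnegrE ?(ltW c0) // ltW.
(* The numerator uses [S c <= 2], the denominator [S c >= 1 - c >= 1 - r]. *)
have hS : `|S c ^+ p / S c| <= 2 ^+ p / (1 - r).
  rewrite ger0_norm; last by rewrite divr_ge0 ?exprn_ge0 ?sqrtr_ge0.
  apply: ler_pM; rewrite ?exprn_ge0 ?invr_ge0 ?sqrtr_ge0 //.
    rewrite lerXn2r ?nnegrE ?sqrtr_ge0 //.
    rewrite -[leRHS]ger0_norm // -sqrtr_sqr ler_wsqrtr //.
    by case/andP: c01 => c0' c1; rewrite gegen_quad_le4 // c0' ltW.
  rewrite lef_pV2 ?posrE ?subr_gt0 ?Sgt // (le_trans _ (Sge _ c01)) //.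
  by rewrite lerD2l lerN2 ltW.
rewrite normrM (ger0_norm r0) normrM.
apply: (@le_trans _ _ (2 ^+ p / (1 - r) * (2 * (p.+1%:R * W * r ^+ M)) * 1)).
  by apply: ler_pM; rewrite ?mulr_ge0 ?normr_ge0 // ?(ltW r1) //; exact: ler_pM.
rewrite le_eqVlt; apply/orP; left; apply/eqP.
by rewrite exprS /W; ring.
Qed.

End GegenbauerGeneratingFunction.

(** * Maximum principle *)

Section LaplacianMaximumPrinciple.
Context {R : realType}.

(** The two difference quotients are the same function of [h]. This carries the one-variable chain
    rule, mean value theorem and extremum criterion over to directional derivatives. *)
Lemma is_derive_line (V : normedModType R) (f : V -> R) (x v : V) (t d : R) :
  is_derive t 1 (fun h : R => f (h *: v + x)) d <-> is_derive (t *: v + x) v f d.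
Proof.
have e : (fun h => h^-1 *: (((fun h => f (h *: v + x)) \o shift t) (h *: 1)
                            - f (t *: v + x)))
       = (fun h => h^-1 *: ((f \o shift (t *: v + x)) (h *: v) - f (t *: v + x))).
  by apply/funext => h /=; rewrite scaler1 scalerDl addrA.
by split=> -[a b]; split; move: a b; rewrite /derivable /derive e.
Qed.

Lemma is_derive_line0 (V : normedModType R) (f : V -> R) (x v : V) (d : R) :
  is_derive (0 : R) 1 (fun h : R => f (h *: v + x)) d <-> is_derive x v f d.
Proof. by have := is_derive_line f x v 0 d; rewrite scale0r add0r. Qed.

Lemma is_derive_chain (V : normedModType R) (g : R -> R) (f : V -> R) (x v : V)
    (a b : R) :
  is_derive (f x) 1 g a -> is_derive x v f b -> is_derive x v (g \o f) (a * b).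
Proof.
move=> dg /is_derive_line0 df; apply/is_derive_line0.
by apply: is_derive1_comp; rewrite scale0r add0r.
Qed.

(** On the line through [x] the first derivative vanishes at the maximum. Were [w] positive, it
    would be positive just to the right of 0, and the mean value theorem would give a larger value
    of [f]. *)
Lemma second_derive_at_max (V : normedModType R) (f : V -> R) (x v : V) (w : R) :
  (\forall z \near x, derivable f z v) -> is_derive x v ('D_v f) w ->
  (\forall z \near x, f z <= f x) -> w <= 0.
Proof.
move=> df ddf fmax; rewrite leNgt; apply/negP => w0.
pose g (h : R) := f (h *: v + x).
have c0 : (fun h : R => h *: v + x) @ 0 --> x.
  rewrite -[X in _ --> X](add0r x) -[X in X + _](scale0r v).
  by apply: cvgD; [apply: cvgZr_tmp; exact: cvg_id | exact: cvg_cst].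
have dg : \forall h \near (0 : R), is_derive (h : R) (1 : R) g ('D_v f (h *: v + x)).
  have df0 : \forall h \near (0 : R), derivable f (h *: v + x) v by exact: (c0 _ df).
  by apply: filterS df0 => h hh; apply/is_derive_line/derivableP.
have gmax : \forall h \near (0 : R), g h <= g 0.
  have f0 : \forall h \near (0 : R), f (h *: v + x) <= f x by exact: (c0 _ fmax).
  by apply: filterS f0 => h hh; rewrite /g scale0r add0r.
move/is_derive_line0 : ddf => ddf.
have [e /= e0 he] : exists2 e : R, 0 < e & forall h, `|h| < e ->
    is_derive (h : R) (1 : R) g ('D_v f (h *: v + x)) /\ g h <= g 0.
  have /nbhs_ballP[e /= e0 he] : \forall h \near (0 : R),
      is_derive (h : R) (1 : R) g ('D_v f (h *: v + x)) /\ g h <= g 0.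
    by near=> h; split; near: h.
  by exists e => // h hh; apply: he; rewrite /ball /= sub0r normrN.
have D0 : 'D_v f x = 0.
  have d0 : is_derive (0 : R) (1 : R) g 0.
    apply: (@derive1_at_max _ g (- e) e 0).
    - by rewrite lerNl (le_trans _ (ltW e0)) // oppr_le0 ltW.
    - move=> t; rewrite in_itv /= -ltr_norml => /he[] /(@ex_derive _ _ _ _ _ _ _); exact.
    - by rewrite in_itv /= oppr_lt0 e0.
    - by move=> t; rewrite in_itv /= -ltr_norml => /he[].
  have [d1 _] : is_derive (0 : R) (1 : R) g ('D_v f (0 *: v + x)) /\ g 0 <= g 0.
    by apply: he; rewrite normr0.
  have := @derive_val _ _ _ _ _ _ _ d1; rewrite (@derive_val _ _ _ _ _ _ _ d0).
  by rewrite scale0r add0r.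
have [d /= d0 hd] : exists2 d : R, 0 < d & forall h, 0 < h < d ->
    0 < 'D_v f (h *: v + x).
  pose k (h : R) := 'D_v f (h *: v + x).
  have kw : h^-1 *: ((k \o shift 0) (h *: 1) - k 0) @[h --> 0^'] --> w.
    by rewrite -(@derive_val _ _ _ _ _ _ _ ddf); exact: (@ex_derive _ _ _ _ _ _ _ ddf).
  have /nbhs_ballP[d /= d0 hd] : \forall h \near (0 : R),
      h != 0 -> 0 < h^-1 *: ((k \o shift 0) (h *: 1) - k 0).
    exact: (cvgr_gt _ kw _ w0).
  exists d => // h /andP[h0 hlt].
  have := hd h; rewrite /ball /= sub0r normrN gtr0_norm // => /(_ hlt).
  rewrite gt_eqF // => /(_ isT).
  by rewrite /k scaler1 addr0 scale0r add0r D0 subr0 pmulr_rgt0 ?invr_gt0.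
(* Below [e] the function is differentiable and at most [g 0]; below [d] its derivative is
   positive. *)
pose s := Num.min (e / 2) (d / 2).
have s0 : 0 < s by rewrite lt_min !divr_gt0.
have se : s < e by rewrite gt_min; apply/orP; left; rewrite ltr_pdivrMr // ltr_pMr // ltr1n.
have sd : s < d.
  by rewrite gt_min; apply/orP; right; rewrite ltr_pdivrMr // ltr_pMr // ltr1n.
have ds h : h \in `]0, s[ -> is_derive (h : R) (1 : R) g ('D_v f (h *: v + x)).
  rewrite in_itv /= => /andP[h0 hs]; apply: (he h _).1.
  by rewrite gtr0_norm // (lt_trans hs).
have cs : {within `[0, s], continuous g}.
  apply: derivable_within_continuous => h; rewrite in_itv /= => /andP[h0 hs].
  have [dh _] : is_derive (h : R) (1 : R) g ('D_v f (h *: v + x)) /\ g h <= g 0.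
    by apply: he; rewrite ger0_norm // (le_lt_trans hs).
  exact: (@ex_derive _ _ _ _ _ _ _ dh).
have [c] := MVT s0 ds cs.
rewrite in_itv /= subr0 => /andP[c1 c2] gs.
have : 0 < g s - g 0.
  by rewrite gs mulr_gt0 // hd // c1 (lt_trans c2).
have /he[_ sle] : `|s| < e by rewrite gtr0_norm.
by rewrite subr_gt0 ltNge sle.
Unshelve. all: by end_near. Qed.

(* Only a pure second derivative is required, not C^2: easy to verify for
   explicit functions, and enough for the maximum principle. *)
Definition has_second_derivative (V : normedModType R) (f : V -> R) (x v : V) (w : R) :=
  (\forall z \near x, derivable f z v) /\ is_derive x v ('D_v f) w.

Section SecondDerivative.
Context {V : normedModType R}.
Implicit Types (f g : V -> R) (x v : V) (a b k : R).

Lemma has_second_derivativeD f g x v a b :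
  has_second_derivative f x v a -> has_second_derivative g x v b ->
  has_second_derivative (f + g) x v (a + b).
Proof.
move=> [df df2] [dg dg2]; split.
  by apply: filterS2 df dg => z; exact: derivableD.
apply: near_eq_is_derive (is_deriveD df2 dg2).
by apply: filterS2 df dg => z dfz dgz; rewrite deriveD.
Qed.

Lemma has_second_derivativeZ f x v a k :
  has_second_derivative f x v a -> has_second_derivative (k \*: f) x v (k * a).
Proof.
move=> [df df2]; split.
  by apply: filterS df => z; exact: derivableZ.
apply: near_eq_is_derive (is_deriveZ k df2).
by apply: filterS df => z dfz; rewrite deriveZ.
Qed.

Lemma has_second_derivative0 x v : has_second_derivative (fun=> 0) x v 0.
Proof.
split; first by apply: nearW => z; exact: derivable_cst.
have -> : 'D_v (fun=> 0 : R) = (fun=> 0).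
  by apply/funext => z; rewrite derive_cst.
exact: is_derive_cst.
Qed.

Lemma near_eq_has_second_derivative f g x v a :
  (\forall z \near x, f z = g z) ->
  has_second_derivative f x v a -> has_second_derivative g x v a.
Proof.
move=> fg [df df2]; split.
  near=> z; apply: (@near_eq_derivable _ _ _ f); last by near: z.
  by near: z; exact: near_join.
apply: near_eq_is_derive df2.
near=> z; apply: near_eq_derive.
by near: z; exact: near_join.
Unshelve. all: by end_near. Qed.

(** The entry point for explicit functions: a formula [df] for the first derivative on an open set
    agrees with ['D_v f] near [x], so differentiating the formula is enough. *)
Lemma has_second_derivative_open (A : set V) f (df : V -> R) x v a :
  open A -> A x -> (forall z, A z -> is_derive z v f (df z)) ->
  is_derive x v df a -> has_second_derivative f x v a.
Proof.
move=> oA Ax dA ddf.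
have nA : \forall z \near x, A z by exact: open_nbhs_nbhs.
split.
  near=> z; have /dA[] : A z by near: z.
  by [].
apply: near_eq_is_derive ddf.
near=> z; have /dA[_ //] : A z by near: z.
Unshelve. all: by end_near. Qed.

End SecondDerivative.

(** A relation rather than an equation on [laplacian], so that existence of the second derivatives
    is part of the claim and passes through sums and multiples. *)
Definition has_laplacian n (f : 'rV[R]_n -> R) (x : 'rV[R]_n) (d : R) :=
  exists w : 'I_n -> R,
    (forall i, has_second_derivative f x (delta_mx 0 i) (w i))
    /\ d = \sum_(i < n) w i.

Lemma has_laplacianD n (f g : 'rV[R]_n -> R) x a b :
  has_laplacian f x a -> has_laplacian g x b -> has_laplacian (f + g) x (a + b).
Proof.
move=> [u [df ->]] [w [dg ->]].
exists (fun i => u i + w i); split=> [i|]; last by rewrite big_split.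
exact: has_second_derivativeD.
Qed.

Lemma has_laplacianZ n (f : 'rV[R]_n -> R) x a k :
  has_laplacian f x a -> has_laplacian (k \*: f) x (k * a).
Proof.
move=> [u [df ->]].
exists (fun i => k * u i); split=> [i|]; last by rewrite mulr_sumr.
exact: has_second_derivativeZ.
Qed.

Lemma has_laplacian0 n x : has_laplacian (fun=> 0 : R) (x : 'rV[R]_n) 0.
Proof.
exists (fun=> 0); split=> [i|]; last by rewrite big1.
exact: has_second_derivative0.
Qed.

Lemma has_laplacian_sum n (I : Type) (r : seq I) (f : I -> 'rV[R]_n -> R) x :
  (forall i, has_laplacian (f i) x 0) ->
  has_laplacian (fun z => \sum_(i <- r) f i z) x 0.
Proof.
move=> H; elim: r => [|i r IH].
  have -> : (fun z => \sum_(i <- [::]) f i z) = (fun=> 0).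
    by apply/funext => z; rewrite big_nil.
  exact: has_laplacian0.
have -> : (fun z => \sum_(j <- i :: r) f j z)
          = f i + (fun z => \sum_(j <- r) f j z).
  by apply/funext => z; rewrite big_cons.
by have := has_laplacianD (H i) IH; rewrite addr0.
Qed.

Lemma near_eq_has_laplacian n (f g : 'rV[R]_n -> R) x a :
  (\forall z \near x, f z = g z) -> has_laplacian f x a -> has_laplacian g x a.
Proof.
move=> fg [u [df ->]]; exists u; split=> // i.
exact: near_eq_has_second_derivative fg (df i).
Qed.

Lemma harmonic_has_laplacian n (A : set 'rV[R]_n) f x :
  open A -> harmonic_on A f -> A x -> has_laplacian f x 0.
Proof.
move=> oA [[_ C2] lf] Ax; exists (fun i => partial i (partial i f) x).
split=> [i|]; last exact/esym/lf.
apply: (has_second_derivative_open oA Ax).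
  by move=> z Az; apply: derivableP; exact: (C2 (delta_mx 0 i)).1.
apply: derivableP.
exact: ((C2 (delta_mx 0 i)).2.2 (delta_mx 0 i)).1.
Qed.

Lemma has_laplacian_at_max n (f : 'rV[R]_n -> R) x d :
  has_laplacian f x d -> (\forall z \near x, f z <= f x) -> d <= 0.
Proof.
move=> [w [df ->]] fmax; apply: sumr_le0 => i _.
exact: second_derive_at_max (df i).1 (df i).2 fmax.
Qed.

Lemma is_derive_coord n (x : 'rV[R]_n) v i :
  is_derive x v (fun z : 'rV[R]_n => z 0 i) (v 0 i).
Proof.
apply/is_derive_line0.
have -> : (fun h : R => (h *: v + x) 0 i) = (v 0 i) \*: id + cst (x 0 i).
  by apply/funext => h; rewrite !mxE /= mulrC.
have := is_deriveD (is_deriveZ (v 0 i) (is_derive_id (0 : R) 1)) (is_derive_cst (x 0 i) (0:R) 1).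
by rewrite addr0 [_ *: _]mulr1.
Qed.

Lemma is_derive_dotp n (x v y : 'rV[R]_n) :
  is_derive x v (fun z => dotp z y) (dotp v y).
Proof.
have -> : (fun z => dotp z y) = \sum_(i < n) (y 0 i \*: (fun z : 'rV[R]_n => z 0 i)).
  by apply/funext => z; rewrite fct_sumE; apply: eq_bigr => i _; rewrite /= mulrC.
apply: is_derive_eq.
  by apply: is_derive_sum => i; apply: is_deriveZ; exact: is_derive_coord.
by apply: eq_bigr => i _; rewrite [_ *: _]mulrC.
Qed.

Lemma is_derive_dotp_sqr n (x v : 'rV[R]_n) :
  is_derive x v (fun z => dotp z z) (2 * dotp v x).
Proof.
have -> : (fun z => dotp z z) =
    \sum_(i < n) ((fun z : 'rV[R]_n => z 0 i) * (fun z : 'rV[R]_n => z 0 i)).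
  by apply/funext => z; rewrite fct_sumE.
apply: is_derive_eq.
  by apply: is_derive_sum => i; apply: is_deriveM; exact: is_derive_coord.
rewrite mulr_sumr; apply: eq_bigr => i _.
by rewrite /GRing.scale /=; ring.
Qed.

Lemma dotp_delta n (i : 'I_n) (y : 'rV[R]_n) : dotp (delta_mx 0 i) y = y 0 i.
Proof.
rewrite /dotp (bigD1 i) //= big1 ?addr0 ?mxE ?eqxx ?mul1r // => j ji.
by rewrite mxE (negPf ji) andbF mul0r.
Qed.

Lemma has_laplacian_dotp n (x : 'rV[R]_n) :
  has_laplacian (fun z => dotp z z) x (2 * n%:R).
Proof.
exists (fun=> 2); split=> [i|]; last by rewrite sumr_const card_ord mulr_natr.
apply: (@has_second_derivative_open _ setT _ (2 \*: (fun z : 'rV[R]_n => z 0 i))).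
- exact: openT.
- by [].
- by move=> z _; apply: is_derive_eq (is_derive_dotp_sqr z _) _; rewrite dotp_delta.
- apply: is_derive_eq (is_deriveZ 2 (is_derive_coord x _ i)) _.
  by rewrite mxE !eqxx [_ *: _]mulr1.
Qed.

Lemma continuous_dotp n : continuous (fun z : 'rV[R]_n => dotp z z).
Proof.
apply: continuous_big => [|i _ x].
  exact: add_continuous.
have h : continuous (fun z : 'rV[R]_n => z 0 i) by exact: coord_continuous.
exact: cvgM (h x) (h x).
Qed.

Lemma continuous_dotpr n (y : 'rV[R]_n) : continuous (fun z : 'rV[R]_n => dotp z y).
Proof.
apply: continuous_big => [|i _ x].
  exact: add_continuous.
have h : continuous (fun z : 'rV[R]_n => z 0 i) by exact: coord_continuous.
by apply: cvgM (h x) _; exact: cvg_cst.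
Qed.

Lemma dotp_ge0 n (x : 'rV[R]_n) : 0 <= dotp x x.
Proof. by apply: sumr_ge0 => i _; rewrite -expr2 sqr_ge0. Qed.

(* f + e |x|^2 has a positive Laplacian, so its maximum over K is not attained in A. *)
Lemma maximum_principle n (K A : set 'rV[R]_n) (f F : 'rV[R]_n -> R) b :
  (0 < n)%N -> compact K -> open A -> A `<=` K ->
  {within K, continuous F} -> (forall x, A x -> f x = F x) ->
  (forall x, A x -> has_laplacian f x 0) ->
  (forall x, K x -> ~ A x -> F x <= b) ->
  forall x, A x -> F x <= b.
Proof.
move=> n0 cK oA AK cF fF lf Fb x Ax; rewrite leNgt; apply/negP => bF.
have K0 : K !=set0 by exists x; exact: AK.
have cdot : {within K, continuous (fun z : 'rV[R]_n => dotp z z)}.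
  by apply: continuous_subspaceT; exact: continuous_dotp.
have [m _ hm] := compact_EVT_max K0 cK cdot.
pose M := dotp m m.
have M0 : 0 <= M by exact: dotp_ge0.
(* Since [M] is the maximum of the squared norm on [K], the perturbation is at most
   [e * M < F x - b] there. Points of [K] outside [A] then stay below the perturbed value at [x]. *)
pose e := (F x - b) / (2 * (M + 1)).
have e0 : 0 < e by rewrite divr_gt0 ?subr_gt0 // mulr_gt0 // ltr_wpDl.
have eM : e * M < F x - b.
  rewrite /e mulrAC ltr_pdivrMr ?mulr_gt0 // ?ltr_wpDl //.
  by rewrite ltr_pM2l ?subr_gt0 //; lra.
have cG : {within K, continuous (F + (e \*: (fun z : 'rV[R]_n => dotp z z)))}.
  move=> z; apply: cvgD; first exact: cF.
  apply: cvgZr; exact: cdot.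
have [c cK' hc] := compact_EVT_max K0 cK cG.
have [cA|cnA] := pselect (A c); last first.
  have := hc x; rewrite inE => /(_ (AK _ Ax)) /=.
  have := Fb c (set_mem cK') cnA; have := hm c cK'; rewrite -/M => cM Fcb.
  have : 0 <= e *: dotp x x by rewrite mulr_ge0 ?dotp_ge0 // ltW.
  have : e *: dotp c c <= e * M by rewrite ler_wpM2l // ltW.
  rewrite !fctE /=; move: (e *: dotp x x) (e *: dotp c c) => ? ?; lra.
have := has_laplacianD (lf _ cA) (has_laplacianZ e (has_laplacian_dotp c)).
move/has_laplacian_at_max.
have nA : nbhs c A by exact: open_nbhs_nbhs.
have H : \forall z \near c, (f + e \*: (fun z : 'rV[R]_n => dotp z z)) z <=
    (f + e \*: (fun z : 'rV[R]_n => dotp z z)) c.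
  near=> z; have Az : A z by near: z.
  by rewrite /= !fctE !fF //; apply: hc; rewrite inE; exact: AK.
move=> /(_ H); rewrite add0r leNgt => /negP; apply.
by rewrite pmulr_rgt0 // pmulr_rgt0 // ltr0n.
Unshelve. all: by end_near. Qed.

End LaplacianMaximumPrinciple.

(** * Zonal harmonic functions *)

Section HarmonicZonalFunctions.
Context {R : realType} {n : nat}.
Implicit Types (x y z xi : 'rV[R]_n) (P : {poly R}).

Lemma enorm_ge0 x : 0 <= enorm x.
Proof. exact: sqrtr_ge0. Qed.

Lemma sqr_enorm x : enorm x ^+ 2 = dotp x x.
Proof. by rewrite sqr_sqrtr // dotp_ge0. Qed.

Lemma dotpC x y : dotp x y = dotp y x.
Proof. by apply: eq_bigr => i _; rewrite mulrC. Qed.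

Lemma dotpZl k x y : dotp (k *: x) y = k * dotp x y.
Proof. by rewrite mulr_sumr; apply: eq_bigr => i _; rewrite mxE mulrA. Qed.

Lemma dotpZr k x y : dotp x (k *: y) = k * dotp x y.
Proof. by rewrite dotpC dotpZl dotpC. Qed.

Lemma dotpBl x y z : dotp (x - y) z = dotp x z - dotp y z.
Proof.
by rewrite /dotp -sumrB; apply: eq_bigr => i _; rewrite !mxE mulrBl.
Qed.

Lemma dotpBr x y z : dotp x (y - z) = dotp x y - dotp x z.
Proof. by rewrite dotpC dotpBl !(dotpC _ x). Qed.

Lemma enormZ k x : enorm (k *: x) = `|k| * enorm x.
Proof.
by rewrite /enorm dotpZl dotpZr mulrA -expr2 sqrtrM ?sqr_ge0 // sqrtr_sqr.
Qed.

Lemma continuous_enorm : continuous (@enorm R n).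
Proof.
move=> x; apply: (@continuous_comp _ _ _ (fun z => dotp z z) Num.sqrt).
  exact: continuous_dotp.
exact: sqrt_continuous.
Qed.

Lemma enorm_normalize x : 0 < enorm x -> enorm ((enorm x)^-1 *: x) = 1.
Proof.
by move=> x0; rewrite enormZ ger0_norm ?invr_ge0 ?ltW // mulVf // gt_eqF.
Qed.

(* Lagrange's identity in the form |y - (x.y) x|^2 = 1 - (x.y)^2. *)
Lemma cauchy_schwarz_unit x y : enorm x = 1 -> enorm y = 1 -> `|dotp x y| <= 1.
Proof.
move=> x1 y1.
have xx : dotp x x = 1 by rewrite -sqr_enorm x1 expr1n.
have yy : dotp y y = 1 by rewrite -sqr_enorm y1 expr1n.
have := dotp_ge0 (y - dotp x y *: x).
rewrite dotpBl !dotpBr !dotpZl !dotpZr xx yy (dotpC y x).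
set t := dotp x y => h.
have h2 : t ^+ 2 <= 1 ^+ 2 by rewrite expr1n expr2; lra.
by rewrite -ler_sqr ?nnegrE // real_normK ?num_real.
Qed.

Lemma is_derive_enorm x v : 0 < enorm x ->
  is_derive x v (@enorm R n) (dotp v x / enorm x).
Proof.
move=> x0.
have d0 : 0 < dotp x x by rewrite -sqrtr_gt0.
have d := @is_derive_chain R _ Num.sqrt (fun z => dotp z z) x v _ _
  (is_derive1_sqrt d0) (is_derive_dotp_sqr x v).
apply: is_derive_eq d _; rewrite -/(enorm x).
by field; rewrite gt_eqF.
Qed.

Lemma is_derive_enormV x v : 0 < enorm x ->
  is_derive x v (fun z => (enorm z)^-1) (- (dotp v x * (enorm x)^-1 ^+ 3)).
Proof.
move=> x0; have xn0 : enorm x != 0 by rewrite gt_eqF.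
have dV : is_derive (enorm x) 1 (fun y : R => y^-1) (- (enorm x) ^- 2 *: 1).
  exact: (@is_deriveV R id (enorm x) 1 1).
have d := @is_derive_chain R _ _ (@enorm R n) x v _ _ dV (is_derive_enorm v x0).
rewrite [_ *: _]mulr1 in d.
apply: is_derive_eq d _.
by field.
Qed.

Lemma open_enorm_gt0 : open [set x : 'rV[R]_n | 0 < enorm x].
Proof.
have -> : [set x : 'rV[R]_n | 0 < enorm x] = (@enorm R n) @^-1` [set y | 0 < y] by [].
by apply: open_comp => [x _|]; [exact: continuous_enorm | exact: open_gt].
Qed.

(* The gradients of 1/|x|, of T = x.xi/|x| and of the radial factor W are
   expressed through k = 1/|x|; summing the second derivatives of W P(T) over the
   coordinates only involves |x|^2, x.xi and |xi|^2 and yields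
   W k^2 ((1 - T^2) P'' - (n - 1) T P' + e (e + n - 2) P). *)
Lemma has_laplacian_zonal (W : 'rV[R]_n -> R) (e : R) P xi x :
  0 < enorm x -> enorm xi = 1 ->
  (forall z i, 0 < enorm z ->
    is_derive z (delta_mx 0 i) W (e * z 0 i * (enorm z)^-1 ^+ 2 * W z)) ->
  (forall t, (1 - t ^+ 2) * P^`()^`().[t] - (n%:R - 1) * t * P^`().[t]
             + e * (e + n%:R - 2) * P.[t] = 0) ->
  has_laplacian (fun z => W z * P.[(enorm z)^-1 * dotp z xi]) x 0.
Proof.
move=> x0 xi1 dW ode.
pose K (z : 'rV[R]_n) := (enorm z)^-1.
pose T z := K z * dotp z xi.
pose X i (z : 'rV[R]_n) := z 0 i.
pose dT i z := K z * xi 0 i - T z * X i z * K z ^+ 2.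
have isX i z : is_derive z (delta_mx 0 i) (X i) 1.
  apply: is_derive_eq (is_derive_coord z (delta_mx 0 i) i) _.
  by rewrite mxE !eqxx.
have isK i z : 0 < enorm z -> is_derive z (delta_mx 0 i) K (- (X i z * K z ^+ 3)).
  by move=> z0; apply: is_derive_eq (is_derive_enormV _ z0) _; rewrite dotp_delta.
have isT i z : 0 < enorm z -> is_derive z (delta_mx 0 i) T (dT i z).
  move=> z0.
  apply: is_derive_eq (is_deriveM (isK i z z0) (is_derive_dotp z _ xi)) _.
  by rewrite dotp_delta /GRing.scale /= /dT /T; ring.
have isP i z (Q : {poly R}) : 0 < enorm z ->
    is_derive z (delta_mx 0 i) (horner Q \o T) (Q^`().[T z] * dT i z).
  by move=> z0; apply: is_derive_chain; exact: isT.
pose F1 i : 'rV[R]_n -> R :=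
  (e \*: (X i * (K * K) * W)) * (horner P \o T)
  + W * ((horner P^`() \o T) * (xi 0 i \*: K - T * X i * (K * K))).
(* The second derivative is sorted by the monomials [1], [x_i^2], [x_i xi_i] and [xi_i^2], whose
   sums over [i] are known. *)
exists (fun i => W x * K x ^+ 2 * (e * P.[T x] - T x * P^`().[T x])
   + W x * K x ^+ 4 * ((e ^+ 2 - 2 * e) * P.[T x] + (3 - 2 * e) * T x * P^`().[T x]
        + T x ^+ 2 * P^`()^`().[T x]) * (x 0 i * x 0 i)
   + W x * K x ^+ 3 * (2 * (e - 1) * P^`().[T x]
        - 2 * T x * P^`()^`().[T x]) * (x 0 i * xi 0 i)
   + W x * K x ^+ 2 * P^`()^`().[T x] * (xi 0 i * xi 0 i)).
split=> [i|].
  have x0' : [set z : 'rV[R]_n | 0 < enorm z] x by exact: x0.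
  apply: (@has_second_derivative_open R _ [set z | 0 < enorm z] _ (F1 i) x
    (delta_mx 0 i) _ open_enorm_gt0 x0').
    move=> z z0; apply: is_derive_eq (is_deriveM (dW z i z0) (isP i z P z0)) _.
    by rewrite /F1 !fctE /= /GRing.scale /= /dT /X /K /T; ring.
  have dKK := is_deriveM (isK i x x0) (isK i x x0).
  have d1 := is_deriveM (is_deriveZ e (is_deriveM (is_deriveM (isX i x) dKK) (dW x i x0)))
     (isP i x P x0).
  have d2 := is_deriveM (dW x i x0) (is_deriveM (isP i x P^`() x0)
     (is_deriveB (is_deriveZ (xi 0 i) (isK i x x0))
       (is_deriveM (is_deriveM (isT i x x0) (isX i x)) dKK))).
  apply: is_derive_eq (is_deriveD d1 d2) _.
  rewrite !fctE /= /GRing.scale /= -/(K x) /dT /X.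
  by ring.
rewrite !big_split /= -!mulr_sumr -!/(dotp _ _) sumr_const card_ord.
rewrite -!sqr_enorm xi1 expr1n.
have Kx : K x * enorm x = 1 by rewrite mulVf // gt_eqF.
have -> : dotp x xi = enorm x * T x by rewrite /T mulrA [enorm x * _]mulrC Kx mul1r.
transitivity (W x * K x ^+ 2 * ((1 - T x ^+ 2) * P^`()^`().[T x]
  - (n%:R - 1) * T x * P^`().[T x] + e * (e + n%:R - 2) * P.[T x])).
  by rewrite ode mulr0.
(* Powers of [K x] are cancelled against [enorm x] by hand, as [ring] does not see
   [K x * enorm x = 1]. *)
have r4 a : W x * K x ^+ 4 * a * enorm x ^+ 2 = W x * K x ^+ 2 * a.
  transitivity (W x * a * (K x * enorm x) ^+ 2 * K x ^+ 2); first by ring.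
  by rewrite Kx; ring.
have r3 a : W x * K x ^+ 3 * a * (enorm x * T x) = W x * K x ^+ 2 * a * T x.
  transitivity (W x * a * T x * (K x * enorm x) * K x ^+ 2); first by ring.
  by rewrite Kx; ring.
by rewrite r4 r3 -[_ *+ n]mulr_natr; ring.
Qed.

(** The radial factor of degree [e = m], in the form that [has_laplacian_zonal] asks for; the next
    lemma is the case [e = - m]. *)
Lemma is_derive_enorm_exp m z i : 0 < enorm z ->
  is_derive z (delta_mx 0 i) (fun x => enorm x ^+ m)
    (m%:R * z 0 i * (enorm z)^-1 ^+ 2 * enorm z ^+ m).
Proof.
move=> z0; have zn0 : enorm z != 0 by rewrite gt_eqF.
have := is_deriveX m (is_derive_enorm (delta_mx 0 i) z0); rewrite exprfctE.
move=> d; apply: is_derive_eq d _; rewrite dotp_delta /GRing.scale /=.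
case: m => [|m]; first by rewrite !mul0r.
by rewrite [enorm z ^+ m.+1]exprS /=; field.
Qed.

Lemma is_derive_enormV_exp m z i : 0 < enorm z ->
  is_derive z (delta_mx 0 i) (fun x => (enorm x)^-1 ^+ m)
    (- m%:R * z 0 i * (enorm z)^-1 ^+ 2 * (enorm z)^-1 ^+ m).
Proof.
move=> z0.
have := is_deriveX m (is_derive_enormV (delta_mx 0 i) z0); rewrite exprfctE.
move=> d; apply: is_derive_eq d _; rewrite dotp_delta /GRing.scale /=.
case: m => [|m]; first by rewrite oppr0 !mul0r.
by rewrite [_ ^+ m.+1]exprS /=; ring.
Qed.

End HarmonicZonalFunctions.

(** * Topology of the annulus and the maximum principle on it *)

Section Annulus.
Context {R : realType} {n : nat} (a : R).
Local Notation A := (annulus n a).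

Lemma open_annulus : open A.
Proof.
have -> : A = (@enorm R n @^-1` [set r | a < r]) `&` (@enorm R n @^-1` [set r | r < 1]).
  by apply/seteqP; split=> [x /= /andP[]|x /= [? ?]] //; apply/andP.
apply: openI; apply: open_comp.
- by move=> x _; exact: continuous_enorm.
- exact: open_gt.
- by move=> x _; exact: continuous_enorm.
- exact: open_lt.
Qed.

Lemma closure_annulus x : closure A x -> a <= enorm x <= 1.
Proof.
have ca : closed (@enorm R n @^-1` [set r | a <= r]).
  by apply: closed_comp => [z _|]; [exact: continuous_enorm | exact: closed_ge].
have c1 : closed (@enorm R n @^-1` [set r | r <= 1]).
  by apply: closed_comp => [z _|]; [exact: continuous_enorm | exact: closed_le].
rewrite closureE => Ax; apply/andP.
apply: (Ax _ (conj (closedI ca c1) _)) => z /= /andP[az z1].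
by split; exact: ltW.
Qed.

Lemma frontier_annulus x : frontier A x -> enorm x = a \/ enorm x = 1.
Proof.
move=> [/closure_annulus /andP[ax x1]]; rewrite (interior_id _).1; last exact: open_annulus.
rewrite /annulus /=.
have [->|xa] := eqVneq (enorm x) a; first by left.
have [->|xn1] := eqVneq (enorm x) 1; first by right.
by case; rewrite !lt_neqAle eq_sym xa ax xn1 x1.
Qed.

Lemma le_coord_enorm (x : 'rV[R]_n) i : `|x 0 i| <= enorm x.
Proof.
rewrite -sqrtr_sqr ler_wsqrtr // /dotp (bigD1 i) //= expr2 lerDl.
by apply: sumr_ge0 => j _; rewrite -expr2 sqr_ge0.
Qed.

Lemma compact_closure_annulus : compact (closure A).
Proof.
have cbox := rV_compact (fun _ : 'I_n => @segment_compact R (- 1) 1).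
apply: subclosed_compact cbox _; first exact: closed_closure.
move=> x /closure_annulus /andP[_ x1] i /=.
by rewrite in_itv /= -ler_norml (le_trans (le_coord_enorm _ _)).
Qed.

(** The maximum principle for [F] and [- F]. Two functions appear because the Laplacian is known for
    one expression and continuity up to the boundary for another; they agree inside. *)
Lemma annulus_abs_maximum (f F : 'rV[R]_n -> R) b :
  (0 < n)%N -> {within closure A, continuous F} ->
  (forall x, A x -> f x = F x) ->
  (forall x, A x -> has_laplacian f x 0) ->
  (forall x, frontier A x -> `|F x| <= b) ->
  forall x, A x -> `|F x| <= b.
Proof.
move=> n0 cF fF lf Fb x Ax.
have bd z : closure A z -> ~ A z -> `|F z| <= b.
  by move=> ? nA; apply: Fb; split => // /(@interior_subset _ A).
rewrite ler_norml; apply/andP; split; last first.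
  apply: (maximum_principle n0 compact_closure_annulus open_annulus
    (@subset_closure _ A) cF fF lf) => // z cz nz.
  by apply: le_trans (bd z cz nz); exact: ler_norm.
rewrite lerNl.
have cN : {within closure A, continuous (fun z => - F z)}.
  by move=> z; apply: cvgN; exact: cF.
apply: (@maximum_principle R n (closure A) A (-1 \*: f) (fun z => - F z) b n0
  compact_closure_annulus open_annulus (@subset_closure _ A) cN) => //.
- by move=> z Az; rewrite /= fF // [_ *: _]mulN1r.
- by move=> z Az; have := has_laplacianZ (-1) (lf z Az); rewrite mulr0.
- move=> z cz nz; apply: le_trans (bd z cz nz).
  by rewrite -normrN; exact: ler_norm.
Qed.

End Annulus.

(** * Zonal harmonics as Gegenbauer polynomials *)

Section ZonalGegenbauer.
Context {R : realType}.

(** Passes from summation over the degree to summation over [k], the indexing of [zonal]. *)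
Lemma horner_gegen v m (t : R) :
  (gegen v m).[t]
  = \sum_(0 <= k < (m./2).+1) gegen_coef v k (m - 2 * k) * t ^+ (m - 2 * k).
Proof.
have -> : gegen v m =
    \sum_(k < (m./2).+1) gegen_coef v k (m - 2 * k) *: 'X^(m - 2 * k) :> {poly R}.
  apply/polyP => i; rewrite coef_sum.
  have [mi|im] := ltnP m i.
    rewrite coef_gegen_small // big1 // => k _.
    rewrite coefZ coefXn; case: eqP => [|_]; [lia | by rewrite mulr0].
  have [h1|ev] := boolP (odd (m - i)).
    rewrite coef_gegen_odd // big1 // => k _; have := ltn_ord k => kM.
    rewrite coefZ coefXn; case: eqP => [ik|_]; [lia | by rewrite mulr0].
  have hk : ((m - i)./2 < (m./2).+1)%N by lia.
  rewrite (bigD1 (Ordinal hk)) //= big1 ?addr0.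
    rewrite coefZ coefXn.
    have e : (m - 2 * (m - i)./2 = i)%N by lia.
    by rewrite e eqxx mulr1 coef_poly ltnS im (negPf ev).
  move=> k /negP nk; rewrite coefZ coefXn; case: eqP => [ik|_]; last by rewrite mulr0.
  case: nk; apply/eqP/val_inj => /=; have := ltn_ord k; lia.
rewrite horner_sum big_mkord; apply: eq_bigr => k _.
by rewrite hornerZ hornerXn.
Qed.

(** In dimension [n = p.+3] the index is [v = n - 2 = p.+1]. For [m > 0] the product in [zonal]
    starts at [n = v + 2] and lacks the first factor [v] of [gegen_coef], whence the division by
    [p.+1]. *)
Lemma zonal_gegen p m (x xi : 'rV[R]_p.+3) : enorm x = 1 ->
  zonal m x xi = (2 * m + p.+1)%:R / p.+1%:R * (gegen p.+1 m).[dotp x xi].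
Proof.
move=> x1; rewrite /zonal; case: eqP => [->|/eqP m0].
  by rewrite gegen0 hornerC mulr1 muln0 add0n divff // pnatr_eq0.
have -> : (p.+3 + 2 * m - 2 = 2 * m + p.+1)%N by lia.
rewrite -mulrA; congr (_ * _).
rewrite horner_gegen mulr_sumr !big_mkord; apply: eq_bigr => k _.
rewrite x1 expr1n mulr1 [RHS]mulrA; congr (_ * _).
have km : (k <= m./2)%N by have := ltn_ord k; lia.
rewrite /gegen_coef [RHS]mulrC -!mulrA; congr (_ * _).
rewrite [LHS]mulrC [RHS]mulrCA; congr (_ * _).
have -> : (k + (m - 2 * k) = (m - k - 1).+1)%N by lia.
rewrite big_nat_recl // muln0 addn0 natrM mulrAC divff ?pnatr_eq0 // mul1r.
by congr (_%:R); apply: eq_bigr => j _; lia.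
Qed.

(** The cosine is 1, so [gegen_at1] applies; for [m > 0] the absorption identities [e1] and [e2]
    express both binomials of [harmonic_dim] through the single one it yields. *)
Lemma zonal_diag p m (x : 'rV[R]_p.+3) : enorm x = 1 ->
  zonal m x x = (harmonic_dim p.+3 m)%:R.
Proof.
move=> x1; rewrite zonal_gegen // -sqr_enorm x1 expr1n gegen_at1.
have p0 : p.+1%:R != 0 :> R by rewrite pnatr_eq0.
apply: (mulfI p0); rewrite mulrA mulrCA divff // mulr1 -!natrM; congr (_%:R).
rewrite /harmonic_dim; case: eqP => [->|/eqP m0].
  by rewrite muln0 !add0n binn.
case: m m0 => // m _.
have -> : (p.+3 + m.+1 - 2 = m.+1 + p.+1)%N by lia.
have -> : (p.+3 + m.+1 - 3 = m + p.+1)%N by lia.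
have -> : (p.+3 - 2 = p.+1)%N by lia.
have e1 : (p.+1 * 'C(m.+1 + p.+1, p.+1) = (m.+1 + p.+1) * 'C(m.+1 + p, p))%N.
  by rewrite -mul_bin_diag addnS.
have e2 : (p.+1 * 'C(m + p.+1, p.+1) = m.+1 * 'C(m.+1 + p, p))%N.
  rewrite -addSnnS mul_bin_left; congr (_ * _)%N; lia.
by rewrite mulnDr e1 e2 -mulnDl; congr (_ * _)%N; lia.
Qed.

End ZonalGegenbauer.

(** * The Green series of the annulus *)

Lemma near_eq_continuous_at (T : topologicalType) (R : realType) (f g : T -> R) (x : T) :
  (\forall z \near x, f z = g z) -> {for x, continuous f} -> {for x, continuous g}.
Proof.
move=> fg cf; rewrite /prop_for /continuous_at -(nbhs_singleton fg).
exact: cvg_trans (near_eq_cvg fg) cf.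
Qed.

Definition green_term (R : realType) n (a : R) (x y : 'rV[R]_n) (m : nat) : R :=
  (enorm x ^+ (2 * m + n - 2) * enorm y ^+ (2 * m + n - 2)
   - a ^+ (2 * m + n - 2) *
       (enorm x ^+ (2 * m + n - 2) + enorm y ^+ (2 * m + n - 2))
   + a ^+ (2 * m + n - 2)) /
  ((2 * m + n - 2)%:R * (enorm x * enorm y) ^+ (n + m - 2)
   * (1 - a ^+ (2 * m + n - 2)))
  * zonal m ((enorm x)^-1 *: x) ((enorm y)^-1 *: y).

(** * A single term of the series: harmonicity and boundary values *)

Section GreenTerm.
Context {R : realType} (p : nat) (a : R) (y : 'rV[R]_p.+3).
Hypothesis a01 : 0 < a < 1.
Hypothesis Ay : annulus p.+3 a y.

Let a0 : 0 < a. Proof. by case/andP: a01. Qed.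
Let a1 : a < 1. Proof. by case/andP: a01. Qed.
Let ay : a < enorm y. Proof. by case/andP: Ay. Qed.
Let y1 : enorm y < 1. Proof. by case/andP: Ay. Qed.
Let y0 : 0 < enorm y. Proof. exact: lt_trans ay. Qed.

Local Notation eta := ((enorm y)^-1 *: y).
Local Notation T x := ((enorm x)^-1 * dotp x eta).

Let oneaN m : 1 - a ^+ (2 * m + p.+1) != 0.
Proof.
rewrite subr_eq0 eq_sym lt_eqF // exprn_ilt1 ?ltW //; lia.
Qed.

Lemma enorm_eta : enorm eta = 1. Proof. exact: enorm_normalize. Qed.

(** With [N = 2 * m + p.+1], the numerator is [|x|^N (|y|^N - a^N) + a^N (1 - |y|^N)], which
    separates the growing radial solution from the decaying one; the factor [N] cancels against the
    one in [zonal]. *)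
Lemma green_termE x m : 0 < enorm x ->
  green_term a x y m =
  (enorm y ^+ (2 * m + p.+1) - a ^+ (2 * m + p.+1))
    / (p.+1%:R * enorm y ^+ (m + p.+1) * (1 - a ^+ (2 * m + p.+1)))
    * (enorm x ^+ m * (gegen p.+1 m).[T x])
  + a ^+ (2 * m + p.+1) * (1 - enorm y ^+ (2 * m + p.+1))
    / (p.+1%:R * enorm y ^+ (m + p.+1) * (1 - a ^+ (2 * m + p.+1)))
    * ((enorm x)^-1 ^+ (m + p.+1) * (gegen p.+1 m).[T x]).
Proof.
move=> x0; rewrite /green_term zonal_gegen ?enorm_normalize // dotpZl.
have -> : (2 * m + p.+3 - 2 = 2 * m + p.+1)%N by lia.
have -> : (p.+3 + m - 2 = m + p.+1)%N by lia.
have -> : enorm x ^+ (2 * m + p.+1) = enorm x ^+ (m + p.+1) * enorm x ^+ m.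
  by rewrite -exprD; congr (_ ^+ _); lia.
rewrite exprMn exprVn; have := oneaN m.
have : enorm x ^+ (m + p.+1) != 0 by rewrite expf_neq0 // gt_eqF.
have : enorm y ^+ (m + p.+1) != 0 by rewrite expf_neq0 // gt_eqF.
have : (2 * m + p.+1)%:R != 0 :> R by rewrite pnatr_eq0; lia.
have : p.+1%:R != 0 :> R by rewrite pnatr_eq0.
move: (enorm y ^+ (2 * m + p.+1)) (a ^+ _) (enorm y ^+ _) (enorm x ^+ (m + _)).
move: (enorm x ^+ m) (2 * m + p.+1)%:R (p.+1%:R) (gegen p.+1 m).[_].
move=> X N P G YN aN Yv Xv h1 h2 h3 h4 h5.
by field; rewrite h1 h2 h3 h4 h5.
Qed.

(** The radial exponents [m] and [- (m + p.+1)] are the two roots of [e (e + n - 2) = m (m + n - 2)]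
    for [n = p.+3], so the Gegenbauer equation serves for both. *)
Lemma has_laplacian_green_term x m : 0 < enorm x ->
  has_laplacian (fun z => green_term a z y m) x 0.
Proof.
move=> x0.
have nx : \forall z \near x, 0 < enorm z.
  by apply: open_nbhs_nbhs; split; [exact: open_enorm_gt0 | exact: x0].
have l1 : has_laplacian (fun z => enorm z ^+ m * (gegen p.+1 m).[T z]) x 0.
  apply: (has_laplacian_zonal (e := m%:R)) => //; first exact: enorm_eta.
    by move=> z i; exact: is_derive_enorm_exp.
  move=> t; rewrite -[RHS](gegen_ode p.+1 m t).
  by rewrite natrD -[p.+3%:R]natr1 -[p.+2%:R]natr1; ring.
have l2 : has_laplacian
    (fun z => (enorm z)^-1 ^+ (m + p.+1) * (gegen p.+1 m).[T z]) x 0.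
  apply: (has_laplacian_zonal (e := - (m + p.+1)%:R)) => //; first exact: enorm_eta.
    by move=> z i; exact: is_derive_enormV_exp.
  move=> t; rewrite -[RHS](gegen_ode p.+1 m t).
  by rewrite natrD -[p.+3%:R]natr1 -[p.+2%:R]natr1; ring.
have := has_laplacianD (has_laplacianZ
  ((enorm y ^+ (2 * m + p.+1) - a ^+ (2 * m + p.+1))
    / (p.+1%:R * enorm y ^+ (m + p.+1) * (1 - a ^+ (2 * m + p.+1)))) l1)
  (has_laplacianZ (a ^+ (2 * m + p.+1) * (1 - enorm y ^+ (2 * m + p.+1))
    / (p.+1%:R * enorm y ^+ (m + p.+1) * (1 - a ^+ (2 * m + p.+1)))) l2).
rewrite !mulr0 addr0; apply: near_eq_has_laplacian.
by near=> z; rewrite green_termE //; near: z.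
Unshelve. all: by end_near. Qed.

Lemma continuous_green_term x m : 0 < enorm x ->
  {for x, continuous (fun z => green_term a z y m)}.
Proof.
move=> x0.
have nx : \forall z \near x, 0 < enorm z.
  by apply: open_nbhs_nbhs; split; [exact: open_enorm_gt0 | exact: x0].
have cE : enorm z @[z --> x] --> enorm x by exact: continuous_enorm.
have cV : (fun z : 'rV[R]_p.+3 => (enorm z)^-1) @ x --> (enorm x)^-1.
  exact: cvgV (lt0r_neq0 x0) cE.
have cG : (fun z => (gegen p.+1 m).[T z]) @ x --> (gegen p.+1 m).[T x].
  have cT : (fun z : 'rV[R]_p.+3 => T z) @ x --> T x.
    by apply: cvgM cV _; exact: continuous_dotpr.
  exact: (cvg_comp _ _ cT (@continuous_horner R (gegen p.+1 m) (T x))).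
have cX (f : 'rV[R]_p.+3 -> R) k : f @ x --> f x -> (fun z => f z ^+ k) @ x --> f x ^+ k.
  by move=> cf; exact: (cvg_comp _ _ cf (@exprn_continuous R k (f x))).
have cg al be : {for x, continuous (fun z : 'rV[R]_p.+3 =>
    al * (enorm z ^+ m * (gegen p.+1 m).[T z])
    + be * ((enorm z)^-1 ^+ (m + p.+1) * (gegen p.+1 m).[T z]))}.
  exact: (cvgD (cvgM (cvg_cst al) (cvgM (cX _ m cE) cG))
               (cvgM (cvg_cst be) (cvgM (cX _ (m + p.+1)%N cV) cG))).
apply: near_eq_continuous_at (cg _ _).
by near=> z; rewrite green_termE //; near: z.
Unshelve. all: by end_near. Qed.

(** On the unit sphere the two numerators of [green_termE] add up to [|y|^N (1 - a^N)], where
    [N = 2 * m + p.+1], and [1 - a^N] cancels. *)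
Lemma green_term_outer x m : enorm x = 1 ->
  green_term a x y m
  = p.+1%:R^-1 * ((gegen p.+1 m).[dotp x eta] * enorm y ^+ m).
Proof.
move=> x1; rewrite green_termE x1 // invr1 mul1r !expr1n !mul1r -mulrDl.
have -> : enorm y ^+ (2 * m + p.+1) = enorm y ^+ (m + p.+1) * enorm y ^+ m.
  by rewrite -exprD; congr (_ ^+ _); lia.
have := oneaN m.
have : enorm y ^+ (m + p.+1) != 0 by rewrite expf_neq0 // gt_eqF.
have : p.+1%:R != 0 :> R by rewrite pnatr_eq0.
move: (a ^+ _) (enorm y ^+ (m + _)) (enorm y ^+ m) p.+1%:R => aN Yv Ym P h1 h2 h3.
by field; rewrite h1 h2 h3.
Qed.

(** Here the numerators, weighted by [a^m] and [a^(-(m + p + 1))], add up to [a^m (1 - a^N)], with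
    [N = 2 * m + p.+1]. *)
Lemma green_term_inner x m : enorm x = a ->
  green_term a x y m
  = (p.+1%:R * enorm y ^+ p.+1)^-1
    * ((gegen p.+1 m).[a^-1 * dotp x eta] * (a / enorm y) ^+ m).
Proof.
move=> xa; rewrite green_termE xa // !mulrA -mulrDl.
rewrite exprVn expr_div_n mulrAC [RHS]mulrAC; congr (_ * _).
have -> : enorm y ^+ (2 * m + p.+1) = enorm y ^+ p.+1 * enorm y ^+ m * enorm y ^+ m.
  by rewrite -!exprD; congr (_ ^+ _); lia.
have aNE : a ^+ (2 * m + p.+1) = a ^+ (m + p.+1) * a ^+ m.
  by rewrite -exprD; congr (_ ^+ _); lia.
have := oneaN m; rewrite aNE [enorm y ^+ (m + _)]exprD.
have : enorm y ^+ p.+1 != 0 by rewrite expf_neq0 // gt_eqF.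
have : enorm y ^+ m != 0 by rewrite expf_neq0 // gt_eqF.
have : a ^+ (m + p.+1) != 0 by rewrite expf_neq0 // gt_eqF.
have : p.+1%:R != 0 :> R by rewrite pnatr_eq0.
move: (a ^+ (m + _)) (a ^+ m) (enorm y ^+ p.+1) (enorm y ^+ m) p.+1%:R.
move=> A am Yv Ym P h1 h2 h3 h4 h5.
by field; rewrite h1 h2 h3 h4 h5.
Qed.

End GreenTerm.

(** * Boundary behaviour and convergence of the series *)

Section GreenSeries.
Context {R : realType} (p : nat) (a : R) (y : 'rV[R]_p.+3).
Hypothesis a01 : 0 < a < 1.
Hypothesis Ay : annulus p.+3 a y.

Let a0 : 0 < a. Proof. by case/andP: a01. Qed.
Let ay : a < enorm y. Proof. by case/andP: Ay. Qed.
Let y1 : enorm y < 1. Proof. by case/andP: Ay. Qed.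
Let y0 : 0 < enorm y. Proof. exact: lt_trans ay. Qed.

Local Notation A := (annulus p.+3 a).
Local Notation eta := ((enorm y)^-1 *: y).

Let y01 : 0 <= enorm y < 1. Proof. by rewrite ltW. Qed.
Let ay01 : 0 <= a / enorm y < 1.
Proof. by rewrite divr_ge0 ?(ltW a0) ?(ltW y0) //= ltr_pdivrMr // mul1r. Qed.

Lemma annulus_enorm_gt0 x : A x -> 0 < enorm x.
Proof. by case/andP => ax _; exact: lt_trans ax. Qed.

Lemma closure_annulus_enorm_gt0 x : closure A x -> 0 < enorm x.
Proof. by move=> /closure_annulus/andP[ax _]; exact: lt_le_trans ax. Qed.

Let dotp_outer x : enorm x = 1 -> `|dotp x eta| <= 1.
Proof. by move=> x1; apply: cauchy_schwarz_unit => //; exact: enorm_eta Ay. Qed.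

Let dotp_inner x : enorm x = a -> `|a^-1 * dotp x eta| <= 1.
Proof.
move=> xa; rewrite -dotpZl; apply: cauchy_schwarz_unit; last exact: enorm_eta Ay.
by rewrite -xa enorm_normalize // xa.
Qed.

Let dist_sqr x :
  dotp (x - y) (x - y) = enorm x ^+ 2 - 2 * (enorm y * dotp x eta) + enorm y ^+ 2.
Proof.
rewrite dotpBl !dotpBr (dotpC y x) !sqr_enorm dotpZr [enorm y * _]mulrA divff ?gt_eqF // mul1r.
by ring.
Qed.

Lemma enorm_dist_outer x : enorm x = 1 ->
  enorm (x - y) = Num.sqrt (gegen_quad (dotp x eta) (enorm y)).
Proof.
move=> x1; rewrite /enorm dist_sqr x1; congr Num.sqrt.
by rewrite /gegen_quad -/(enorm y); ring.
Qed.

(** On the inner sphere [y] is the farther point, so its norm is factored out to leave a ratio below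
    1. *)
Lemma enorm_dist_inner x : enorm x = a ->
  enorm (x - y)
  = enorm y * Num.sqrt (gegen_quad (a^-1 * dotp x eta) (a / enorm y)).
Proof.
move=> xa.
rewrite -[X in X * Num.sqrt _](ger0_norm (ltW y0)) -sqrtr_sqr -sqrtrM ?sqr_ge0 //.
rewrite {1}/enorm dist_sqr xa; congr Num.sqrt; rewrite /gegen_quad.
by field; rewrite !gt_eqF.
Qed.

(** The errors on the outer and inner spheres are added, so that one bound serves on the whole
    frontier and is independent of [x]. *)
Definition green_error M : R :=
  p.+1%:R^-1 * gegen_gen_error p (enorm y) M
  + (p.+1%:R * enorm y ^+ p.+1)^-1 * gegen_gen_error p (a / enorm y) M.

Lemma cvg_green_error : green_error @ \oo --> (0 : R).
Proof.
rewrite -[X in _ --> X](addr0 0) -[X in X + _](mulr0 p.+1%:R^-1).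
rewrite -[X in _ + X](mulr0 (p.+1%:R * enorm y ^+ p.+1)^-1).
by apply: cvgD; apply: cvgMr; exact: cvg_gegen_gen_error.
Qed.

(** On either sphere the sum is a multiple of [gegen_sum], at ratio [enorm y] or [a / enorm y], and
    [gegen_gen] compares it with the power of the distance. *)
Lemma green_partial_sum_frontier x M : frontier A x ->
  `|\sum_(m < M.+1) green_term a x y m - (p.+1%:R * enorm (x - y) ^+ p.+1)^-1|
  <= green_error M.
Proof.
have v0 : 0 <= p.+1%:R^-1 :> R by rewrite invr_ge0.
have vy0 : 0 <= (p.+1%:R * enorm y ^+ p.+1)^-1.
  by rewrite invr_ge0 mulr_ge0 // exprn_ge0 // ltW.
move=> /frontier_annulus[xa|x1].
- under eq_bigr do rewrite green_term_inner //.
  rewrite -mulr_sumr -/(gegen_sum _ _ _ _) enorm_dist_inner // exprMn mulrA.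
  rewrite [(_ * _ * _ ^+ _)^-1]invfM -mulrBr normrM ger0_norm //.
  rewrite /green_error -[leLHS]add0r; apply: lerD.
    by rewrite mulr_ge0 // gegen_gen_error_ge0.
  by rewrite ler_wpM2l // gegen_gen // dotp_inner.
- under eq_bigr do rewrite green_term_outer //.
  rewrite -mulr_sumr -/(gegen_sum _ _ _ _) enorm_dist_outer //.
  rewrite invfM -mulrBr normrM ger0_norm //.
  rewrite /green_error -[leLHS]addr0; apply: lerD.
    by rewrite ler_wpM2l // gegen_gen // dotp_outer.
  by rewrite mulr_ge0 // gegen_gen_error_ge0.
Qed.

Let within_green_term m : {within closure A, continuous (fun z => green_term a z y m)}.
Proof.
apply: continuous_in_subspaceT => z /set_mem /closure_annulus_enorm_gt0 z0.
exact: continuous_green_term.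
Qed.

(** The maximum principle for one term reduces the bound to the two spheres, where [gegen_le_bin]
    applies. *)
Lemma green_term_le x m : A x ->
  `|green_term a x y m|
  <= p.+1%:R^-1 * ('C(m + p, p)%:R * enorm y ^+ m)
     + (p.+1%:R * enorm y ^+ p.+1)^-1 * ('C(m + p, p)%:R * (a / enorm y) ^+ m).
Proof.
have v0 : 0 <= p.+1%:R^-1 :> R by rewrite invr_ge0.
have vy0 : 0 <= (p.+1%:R * enorm y ^+ p.+1)^-1.
  by rewrite invr_ge0 mulr_ge0 // exprn_ge0 // ltW.
have ym : 0 <= enorm y ^+ m by rewrite exprn_ge0 // ltW.
have aym : 0 <= (a / enorm y) ^+ m by rewrite exprn_ge0 //; case/andP: ay01.
move: x; apply: (annulus_abs_maximum (f := fun z => green_term a z y m)) => //.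
- by move=> z Az; apply: has_laplacian_green_term => //; exact: annulus_enorm_gt0.
move=> z /frontier_annulus[za|z1].
- rewrite green_term_inner // normrM ger0_norm // normrM [X in _ * (_ * X)]ger0_norm //.
  rewrite -[leLHS]add0r; apply: lerD; first by rewrite !mulr_ge0.
  by rewrite ler_wpM2l // ler_wpM2r // gegen_le_bin // dotp_inner.
- rewrite green_term_outer // normrM ger0_norm // normrM [X in _ * (_ * X)]ger0_norm //.
  rewrite -[leLHS]addr0; apply: lerD; last by rewrite !mulr_ge0.
  by rewrite ler_wpM2l // ler_wpM2r // gegen_le_bin // dotp_outer.
Qed.

(** Comparison with two geometric series, by [bin_geometric]. The point [x = y] is included, which
    covers the series of the Robin function. *)
Lemma is_cvg_green_series x : A x -> cvgn (series (green_term a x y)).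
Proof.
move=> Ax.
have [K1 [q1 [K10 /andP[q10 q11] h1]]] := bin_geometric p y01.
have [K2 [q2 [K20 /andP[q20 q21] h2]]] := bin_geometric p ay01.
have v0 : 0 <= p.+1%:R^-1 :> R by rewrite invr_ge0.
have vy0 : 0 <= (p.+1%:R * enorm y ^+ p.+1)^-1.
  by rewrite invr_ge0 mulr_ge0 // exprn_ge0 // ltW.
pose w := geometric (p.+1%:R^-1 * K1) q1
  + geometric ((p.+1%:R * enorm y ^+ p.+1)^-1 * K2) q2.
apply: normed_cvg; apply: (@series_le_cvg _ _ w).
- by move=> m; exact: normr_ge0.
- by move=> m; rewrite /w !fctE addr_ge0 // !mulr_ge0 ?exprn_ge0.
- move=> m; apply: le_trans (green_term_le m Ax) _.
  by rewrite /w !fctE /= -!mulrA; apply: lerD; exact: ler_wpM2l.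
- rewrite /w seriesD; apply: is_cvgD; apply: is_cvg_geometric_series.
    by rewrite ger0_norm.
  by rewrite ger0_norm.
Qed.

End GreenSeries.

Lemma continuous_at_sum (T : topologicalType) (R : realType) n (f : 'I_n -> T -> R) x :
  (forall i, {for x, continuous (f i)}) ->
  {for x, continuous (fun z => \sum_(i < n) f i z)}.
Proof.
by move=> cf; apply: cvg_big => [|i _]; [exact: add_continuous | exact: cf].
Qed.

(** Near a point [x] separated from [y], restricting to [K] or to [K] without [y] is the same. This
    moves the boundary continuity of the Green function to the full closure. *)
Lemma cvg_within_setD1 (T : topologicalType) (U : topologicalType) (F f : T -> U)
    (K : set T) (x y : T) (l : U) :
  nbhs x (~` [set y]) -> (forall z, z <> y -> F z = f z) ->
  f @ within (K `\ y) (nbhs x) --> l -> F @ within K (nbhs x) --> l.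
Proof.
move=> nxy Ff fl V /fl nV.
apply: filterS2 nxy nV => z zy + Kz; rewrite /= Ff //.
by apply; split.
Qed.

Lemma enorm_gt0 (R : realType) n (x : 'rV[R]_n) : (0 < enorm x) = (x != 0).
Proof.
rewrite lt_neqAle enorm_ge0 andbT eq_sym; apply/idP/idP; apply: contraNN.
  by move=> /eqP ->; rewrite -(scale0r 0) enormZ normr0 mul0r.
move=> /eqP x0; apply/eqP/rowP => i; rewrite mxE.
by apply/eqP; rewrite -normr_le0 -x0 le_coord_enorm.
Qed.

(** * Identification of the regular part with the series *)

Section GreenFunction.
Context {R : realType} (p : nat) (a : R) (G H : 'rV[R]_p.+3 -> 'rV[R]_p.+3 -> R).
Hypothesis a01 : 0 < a < 1.
Local Notation A := (annulus p.+3 a).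
Hypothesis hG : green_function A G.
Hypothesis hH : regular_part A G H.

Let w : R := (sphere_area R p.+2)^-1.

Lemma fundamental_solutionE (x y : 'rV[R]_p.+3) :
  fundamental_solution x y = w * (p.+1%:R * enorm (x - y) ^+ p.+1)^-1.
Proof.
rewrite /fundamental_solution /w.
have -> : (p.+3 - 2 = p.+1)%N by lia.
by rewrite -invfM mul1r -mulrA mulrCA.
Qed.

Lemma continuous_fundamental_solution (x y : 'rV[R]_p.+3) : x != y ->
  {for x, continuous (fun z => fundamental_solution z y)}.
Proof.
move=> xy.
have c1 : (fun z : 'rV[R]_p.+3 => z - y) @ x --> x - y.
  exact: cvgB cvg_id (cvg_cst y).
have c2 := cvg_comp _ _ c1 (@continuous_enorm R p.+3 (x - y)).
have c3 : (fun z : 'rV[R]_p.+3 => enorm (z - y) ^+ p.+1) @ x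
    --> enorm (x - y) ^+ p.+1.
  exact: (cvg_comp _ _ c2 (@exprn_continuous R p.+1 (enorm (x - y)))).
have e0 : p.+1%:R * enorm (x - y) ^+ p.+1 != 0.
  by rewrite mulf_neq0 ?pnatr_eq0 // expf_neq0 // gt_eqF // enorm_gt0 subr_eq0.
have c4 := cvgM (cvg_cst w) (cvgV e0 (cvgM (cvg_cst (p.+1%:R : R)) c3)).
have -> : (fun z => fundamental_solution z y) =
    (fun z => w * (p.+1%:R * enorm (z - y) ^+ p.+1)^-1).
  by apply/funext => z; rewrite fundamental_solutionE.
exact: c4.
Qed.

Section Pole.
Variable y : 'rV[R]_p.+3.
Hypothesis Ay : A y.

Let S M (x : 'rV[R]_p.+3) := \sum_(m < M.+1) green_term a x y m.

(** Extends [H + w S] to the closure: the hypotheses on [H] only concern the open annulus, those on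
    [G] reach the boundary but leave out the pole, so [G] is used except at [y]. *)
Let F M (x : 'rV[R]_p.+3) :=
  if x == y then H y y + w * S M y
  else G x y - fundamental_solution x y + w * S M x.

Let F_annulus M x : A x -> H x y + w * S M x = F M x.
Proof.
move=> Ax; rewrite /F; case: eqP => [->//|/eqP xy].
by case: hH => _ _ _ /(_ x y Ax Ay xy) ->; rewrite [_ + H x y]addrC addrK.
Qed.

Let continuous_S M x : 0 < enorm x -> {for x, continuous (S M)}.
Proof.
by move=> x0; apply: continuous_at_sum => m; exact: continuous_green_term.
Qed.

(** At the pole, an interior point, [F] agrees nearby with [H + w S]; elsewhere continuity comes
    from [G] and the fundamental solution. *)
Let within_F M : {within closure A, continuous (F M)}.
Proof.
apply/subspace_continuousP => x Kx; rewrite /from_subspace.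
have x0 := closure_annulus_enorm_gt0 a01 Kx.
have [->|xy] := eqVneq x y.
  apply: cvg_within_filter.
  have yA : \forall z \near y, A z.
    by apply: open_nbhs_nbhs; split=> //; exact: open_annulus.
  have nA : \forall z \near y, H z y + w * S M z = F M z.
    by near=> z; apply: F_annulus; near: z.
  apply: (near_eq_continuous_at nA).
  case: hH => _ /(_ y Ay)[[cH _] _] _ _.
  have cS := @continuous_S M _ (annulus_enorm_gt0 a01 Ay).
  exact: (cvgD (cH y Ay) (cvgM (cvg_cst w) cS)).
have nxy : nbhs x (~` [set y]).
  apply: open_nbhs_nbhs; split; last exact/eqP.
  by apply: closed_openC; apply: accessible_closed_set1; exact: hausdorff_accessible.
apply: (cvg_within_setD1 (f := fun z : 'rV[R]_p.+3 => G z y - fundamental_solution z y + w * S M z) nxy).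
  move=> z zy; have /negPf zyF : (z : 'rV[R]_p.+3) != y by apply/eqP.
  by rewrite /F zyF.
rewrite /F (negPf xy).
have [_ /subspace_continuousP cG _] := hG Ay.
have cGx : (fun z => G z y) @ within (closure A `\ y) (nbhs x) --> G x y.
  exact: (cG x (conj Kx (elimN eqP xy))).
have cf : (fun z => fundamental_solution z y) @ within (closure A `\ y) (nbhs x)
    --> fundamental_solution x y.
  by apply: cvg_within_filter; exact: continuous_fundamental_solution.
have cS : S M @ within (closure A `\ y) (nbhs x) --> S M x.
  by apply: cvg_within_filter; exact: continuous_S.
exact: (cvgD (cvgB cGx cf) (cvgM (cvg_cst w) cS)).
Unshelve. all: by end_near. Qed.

(** The case [x = y] is included, so this one identity yields both formulas of the theorem. *)
Lemma regular_part_green_series x : A x ->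
  H x y = - (w * limn (series (green_term a x y))).
Proof.
move=> Ax.
have bd M : `|H x y + w * S M x| <= `|w| * green_error a y M.
  rewrite F_annulus //; move: x Ax.
  apply: (annulus_abs_maximum (f := fun z => H z y + w * S M z)) => //.
  - move=> z Az; exact: F_annulus.
  - move=> z Az.
    have lH : has_laplacian (H^~ y) z 0.
      have hy : harmonic_on A (H^~ y) by case: hH => _ /(_ y Ay).
      exact: (harmonic_has_laplacian (@open_annulus R p.+3 a) hy Az).
    have lS : has_laplacian (S M) z 0.
      apply: has_laplacian_sum => m; apply: has_laplacian_green_term => //.
      exact: annulus_enorm_gt0 Az.
    by have := has_laplacianD lH (has_laplacianZ w lS); rewrite mulr0 addr0.
  - move=> z fz.
    have zy : z != y.
      apply/eqP => zy; case: fz => _.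
      by rewrite (interior_id _).1 ?zy //; exact: open_annulus.
    have [_ _ /(_ z fz) G0] := hG Ay.
    (* As [G] vanishes on the frontier, [F] is [w] times the error of the partial sum there. *)
    rewrite /F (negPf zy) G0 sub0r addrC fundamental_solutionE -mulrBr normrM.
    by rewrite ler_wpM2l // green_partial_sum_frontier.
have cu := is_cvg_green_series a01 Ay Ax.
have c1 : (fun M => H x y + w * S M x) @ \oo -->
    H x y + w * limn (series (green_term a x y)).
  apply: cvgD; first exact: cvg_cst.
  apply: cvgMr.
  (* [S M] has [M.+1] terms, hence a shift by one. *)
  have -> : (S ^~ x) = (fun M => series (green_term a x y) M.+1).
    by apply/funext => M; rewrite /series /= big_mkord.
  by rewrite (cvg_shiftS (series _)).
have c2 : (fun M => H x y + w * S M x) @ \oo --> (0 : R).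
  have cb : (fun M => `|w| * green_error a y M) @ \oo --> (0 : R).
    by rewrite -[X in _ --> X](mulr0 `|w|); apply: cvgMr; exact: cvg_green_error.
  apply/norm_cvg0P; apply: (squeeze_cvgr _ (cvg_cst 0) cb).
  by apply: nearW => M; rewrite normr_ge0 bd.
by apply/eqP; rewrite -addr_eq0; apply/eqP; exact: (cvg_unique _ c1 c2).
Qed.

End Pole.
End GreenFunction.

Theorem theorem1p1 (R : realType) (n : nat) (hn : (3 <= n)%N)
    (a : R) (ha : 0 < a < 1)
    (G H : 'rV[R]_n -> 'rV[R]_n -> R)
    (hG : green_function (annulus n a) G)
    (hH : regular_part (annulus n a) G H) :
  (forall x y : 'rV[R]_n, annulus n a x -> annulus n a y -> x != y ->
     let u := fun m : nat =>
       (enorm x ^+ (2 * m + n - 2) * enorm y ^+ (2 * m + n - 2)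
        - a ^+ (2 * m + n - 2) *
            (enorm x ^+ (2 * m + n - 2) + enorm y ^+ (2 * m + n - 2))
        + a ^+ (2 * m + n - 2)) /
       ((2 * m + n - 2)%:R * (enorm x * enorm y) ^+ (n + m - 2)
        * (1 - a ^+ (2 * m + n - 2)))
       * zonal m ((enorm x)^-1 *: x) ((enorm y)^-1 *: y) in
     cvgn (series u) /\
     G x y = 1 / ((n - 2)%:R * sphere_area R n.-1 * enorm (x - y) ^+ (n - 2))
             - 1 / sphere_area R n.-1 * limn (series u)) /\
  (forall x : 'rV[R]_n, annulus n a x ->
     let v := fun m : nat =>
       (harmonic_dim n m)%:R *
       ((a ^+ (2 * m + n - 2)
         - 2 * a ^+ (2 * m + n - 2) * enorm x ^+ (2 * m + n - 2)
         + enorm x ^+ (4 * m + 2 * n - 4)) /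
        ((2 * m + n - 2)%:R * enorm x ^+ (2 * m + 2 * n - 4)
         * (1 - a ^+ (2 * m + n - 2)))) in
     cvgn (series v) /\
     robin_function H x = - (1 / sphere_area R n.-1) * limn (series v)).
Proof.
(* Writing [n = p.+3] makes [n - 2 = p.+1], the index of the Gegenbauer polynomials. *)
case: n hn G H hG hH => [|[|[|p]]] // _ G H hG hH; split.
- move=> x y Ax Ay xy u; split; first exact: (is_cvg_green_series ha Ay Ax).
  case: (hH) => _ _ _ /(_ x y Ax Ay xy) ->; rewrite /fundamental_solution.
  by rewrite (regular_part_green_series ha hG hH Ay Ax) !div1r.
move=> x Ax v.
have x0 := annulus_enorm_gt0 ha Ax.
(* The Robin summand is the Green summand on the diagonal, by [zonal_diag] and by merging powers of
   [enorm x]. *)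
have -> : v = green_term a x x.
  apply/funext => m; rewrite /v /green_term zonal_diag ?enorm_normalize // mulrC.
  congr (_ / (_ * _ * _) * _); last first.
    by rewrite exprMn -exprD; congr (_ ^+ _); lia.
  have -> : enorm x ^+ (4 * m + 2 * p.+3 - 4)
      = enorm x ^+ (2 * m + p.+3 - 2) * enorm x ^+ (2 * m + p.+3 - 2).
    by rewrite -exprD; congr (_ ^+ _); lia.
  by ring.
split; first exact: (is_cvg_green_series ha Ax Ax).
by rewrite /robin_function (regular_part_green_series ha hG hH Ax Ax) !div1r mulNr.
Qed.
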